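(* Let $H$ be an $\ell$-graph with $e(H)\ge2$ and let $0<\gamma<1$. For some $c>0$, for $N$ sufficiently large and for $p\ge cN^{-1/m(H)}$ (with $p\le 1$), the following event holds with probability greater than $1-\exp\{-\gamma^3p\binom{N}{\ell}/512\}$: $$\text{every } H\text{-free subgraph of } G^{(\ell)}(N,p)\text{ has at most }(\pi(H)+\gamma)\,p\binom{N}{\ell}\text{ edges.}$$
   Context: An $\ell$-graph is an $\ell$-uniform hypergraph; $v(\cdot)$, $e(\cdot)$ denote numbers of vertices and edges. $G^{(\ell)}(N,p)$ is the random $\ell$-graph on vertex set $[N]=\{1,\dots,N\}$ in which each $\ell$-subset of $[N]$ is an edge independently with probability $p$. An $\ell$-graph is $H$-free if it contains no subgraph isomorphic to $H$. For an $\ell$-graph $H$ with $e(H)\ge2$, $$m(H)=\max_{H'\subset H,\ e(H')>1}\frac{e(H')-1}{v(H')-\ell}.$$ $\mathrm{ex}(N,H)$ is the maximum number of edges in an $H$-free $\ell$-graph on $N$ vertices, and $\pi(H)=\lim_{N\to\infty}\mathrm{ex}(N,H)\binom{N}{\ell}^{-1}$. *)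

(* Defs.v *)
From HB Require Import structures.
From mathcomp Require Import all_boot all_order all_algebra.
From mathcomp Require Import all_classical all_reals all_analysis.

Set Implicit Arguments.
Unset Strict Implicit.
Unset Printing Implicit Defensive.

Import Order.TTheory GRing.Theory Num.Theory.
Import numFieldNormedType.Exports.

Local Open Scope ring_scope.

Definition is_lgraph (l : nat) (T : finType)
    (VE : {set T} * {set {set T}}) : bool :=
  [forall e in VE.2, (e \subset VE.1) && (#|e| == l)].

(* The vertex set is an explicit subset of the ambient type, so that a graph
   and its subgraphs, spanning or not, inhabit the same type. *)
Record lgraph (l : nat) (T : finType) := LGraph {
  lgraph_val : {set T} * {set {set T}};
  _ : is_lgraph l lgraph_val }.

HB.instance Definition _ (l : nat) (T : finType) :=
  [isSub for @lgraph_val l T].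
HB.instance Definition _ (l : nat) (T : finType) :=
  [Finite of lgraph l T by <:].

Definition verts (l : nat) (T : finType) (G : lgraph l T) : {set T} :=
  (lgraph_val G).1.

Definition edges (l : nat) (T : finType) (G : lgraph l T) : {set {set T}} :=
  (lgraph_val G).2.

Definition nverts (l : nat) (T : finType) (G : lgraph l T) : nat :=
  #|verts G|.

Definition nedges (l : nat) (T : finType) (G : lgraph l T) : nat :=
  #|edges G|.

Definition subgraph (l : nat) (T : finType) (F G : lgraph l T) : bool :=
  (verts F \subset verts G) && (edges F \subset edges G).

Definition isomorphic (l : nat) (T U : finType)
    (H : lgraph l T) (G : lgraph l U) : bool :=
  [exists f : {ffun T -> U},
    [&& [forall x in verts H, forall y in verts H, (f x == f y) ==> (x == y)],
        f @: verts H == verts G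
      & [set f @: (e : {set T}) | e in edges H] == edges G]].

Definition is_free (l : nat) (T U : finType)
    (H : lgraph l T) (G : lgraph l U) : bool :=
  ~~ [exists F : lgraph l U, subgraph F G && isomorphic H F].

(* If H' has two distinct edges then it has more than l vertices, so the
   quotients are positive; the default value 0 of the maximum is thus never
   attained when H has at least two edges. *)
Definition mdensity (R : realType) (l : nat) (T : finType)
    (H : lgraph l T) : R :=
  \big[Num.max/0]_(H' : lgraph l T | subgraph H' H && (1 < nedges H')%N)
    (((nedges H')%:R - 1) / ((nverts H')%:R - l%:R)).

Definition ex_number (l : nat) (T : finType) (N : nat) (H : lgraph l T) : nat :=
  \max_(G : lgraph l 'I_N | (verts G == [set: 'I_N]) && is_free H G) nedges G.

Definition turan_density (R : realType) (l : nat) (T : finType)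
    (H : lgraph l T) : R :=
  limn (fun N : nat => (ex_number N H)%:R / 'C(N, l)%:R : R).

(* Probability of the event A in the random l-graph G^(l)(N, p): independence
   of the edges gives a graph on N vertices the product weight below. *)
Definition Pr_random_lgraph (R : realType) (l N : nat) (p : R)
    (A : pred (lgraph l 'I_N)) : R :=
  \sum_(G : lgraph l 'I_N | (verts G == [set: 'I_N]) && A G)
    \prod_(e : {set 'I_N} | #|e| == l) (if e \in edges G then p else 1 - p).

(* Main.v *)
Require Import Defs.
From mathcomp Require Import all_boot all_order all_algebra.
From mathcomp Require Import all_classical all_reals all_analysis.
From mathcomp Require Import fintype finset perm zify lra ring.

Set Implicit Arguments.
Unset Strict Implicit.
Unset Printing Implicit Defensive.

Import Order.TTheory GRing.Theory Num.Theory.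
Import numFieldNormedType.Exports.

Local Open Scope ring_scope.

(** Sparse random Turán theorem, by the method of hypergraph containers.

    Regard an l-graph on [N] as a subset of the set of all l-subsets of [N].
    An H-free graph is then an independent set of the hypergraph whose edges
    are the edge sets of the copies of H.  When q >= N^(-1/m(H)), the very
    definition of m(H) bounds the codegrees of this hypergraph
    ([copy_weight_spread]), and the container theorem ([containers]) applies:
    every independent set I has a fingerprint S inside I, of size at most
    b q C(N,l), from which one can compute a set C containing I and spanning
    fewer than alpha N^|T| copies of H.  By [supersaturation], such a C has at
    most (pi(H) + gamma/4) C(N,l) elements ([turan_containers]).

    The container theorem rests on one greedy procedure ([container_step]).
    Vertices of I of large degree are selected one after the other, and the
    links of the selected vertices accumulate in a hypergraph of uniformity one
    less, in which I is again independent.  Either that hypergraph becomes large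
    and one recurses on the uniformity, or the procedure stops while most edges
    are intact, and then the many vertices of large degree that are left lie
    outside I and can be deleted.  Each step selects the first suitable vertex of
    I in a fixed enumeration, so running the procedure on any set between S and I
    gives the same result; this is how C is computed from S.  Deleting a positive proportion of
    the vertices can be repeated a bounded number of times only.

    For the probability, take q = tau p with a small constant tau, so that
    p >= c N^(-1/m(H)) with c >= 1/tau gives q >= N^(-1/m(H)).  If the random
    graph G has an H-free subgraph F with more than (pi(H) + gamma) p C(N,l)
    edges, then G contains the fingerprint S of F and meets the container of S
    in that many edges.  For a fixed S this has probability at most
    (e^lam p)^|S| times a Chernoff factor exp(- gamma^2 p C(N,l) / 16), and the
    sum of (e^lam p)^|S| over the small sets S is only exp(gamma^2 p C(N,l) / 32)
    ([fingerprint_union_bound]).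

    An F on fewer than |T| vertices can be free of H merely for lack of
    vertices, but it has at most 2^|T| edges, at most gamma p C(N,l) once c
    is large, because p C(N,l) >= c N^(-1/m(H)) C(N,l) and m(H) >= 1/l. *)

(** * Weighted hypergraphs and the greedy procedure *)

Section Weights.
Variables (R : realFieldType) (V : finType).
Implicit Types (w g : {set V} -> R) (A B E F I J U : {set V}) (v : V).

(** Hypergraphs are encoded as weight functions on sets of vertices, so that an
    edge that comes from the links of several vertices is counted with
    multiplicity. *)
Definition deg w A : R := \sum_(E : {set V} | A \subset E) w E.

Definition mass w : R := \sum_(E : {set V}) w E.

Definition link w v F : R := if v \in F then 0 else w (v |: F).

Lemma mass_deg0 w : mass w = deg w set0.
Proof. by apply: eq_bigl => E; rewrite sub0set. Qed.

Lemma deg_ge0 w A : (forall E, 0 <= w E) -> 0 <= deg w A.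
Proof. by move=> w0; apply: sumr_ge0. Qed.

Lemma ler_deg w g A : (forall E, w E <= g E) -> deg w A <= deg g A.
Proof. by move=> wg; apply: ler_sum. Qed.

Lemma degD w g A : deg (fun E => w E + g E) A = deg w A + deg g A.
Proof. exact: big_split. Qed.

Lemma deg_link w v A :
  deg (link w v) A = if v \in A then 0 else deg w (v |: A).
Proof.
case: ifP => vA.
  rewrite /deg big1 // => F AF; by rewrite /link (subsetP AF _ vA).
rewrite /deg /link big_mkcond /=.
rewrite (eq_bigr (fun F => if (A \subset F) && (v \notin F) then w (v |: F) else 0)); last first.
  by move=> F _; case: (A \subset F) => //=; case: (v \in F).
rewrite -big_mkcond /=.
rewrite [RHS](reindex_onto (fun F => v |: F) (fun E => E :\ v)); last first.
  by move=> E; rewrite subUset sub1set => /andP[vE _]; rewrite setD1K.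
apply: eq_bigl => F; rewrite subUset sub1set setU11 /=.
case vF: (v \in F) => /=.
  rewrite andbF; apply/esym/negbTE/negP => /andP[_ /eqP FE].
  by move: vF; rewrite -FE !inE eqxx.
rewrite andbT setU1K ?vF // eqxx andbT.
apply/idP/idP => [AF|/subsetP AF]; first exact: subset_trans AF (subsetUr _ _).
apply/subsetP => x xA; move: (AF x xA); rewrite !inE => /orP[/eqP xv|//].
by rewrite -xv xA in vA.
Qed.

(** Every edge of nonzero weight has a vertex in [U], so it is counted at least
    once on the right. *)
Lemma mass_le_sum_deg w U :
  (forall E, 0 <= w E) ->
  (forall E, w E != 0 -> E != set0 /\ E \subset U) ->
  mass w <= \sum_(v in U) deg w [set v].
Proof.
move=> w0 wU.
rewrite /deg (exchange_big_dep predT) //=; apply: ler_sum => E _.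
have [->|wE] := eqVneq (w E) 0; first exact: sumr_ge0.
have [/set0Pn[v vE] EU] := wU _ wE.
rewrite (bigD1 v) /=; last by rewrite (subsetP EU _ vE) sub1set.
by rewrite lerDl sumr_ge0.
Qed.

Lemma sum_deg_uniform w s :
  (forall E, w E != 0 -> #|E| = s) -> \sum_A deg w A = 2 ^+ s * mass w.
Proof.
move=> ws; rewrite /deg (exchange_big_dep predT) //= /mass mulr_sumr.
apply: eq_bigr => E _; have [->|wE] := eqVneq (w E) 0.
  by rewrite mulr0 big1.
rewrite sumr_const.
have -> : #|[pred A : {set V} | A \subset E]| = (2 ^ s)%N.
  rewrite -(ws _ wE) -card_powerset; apply: eq_card => A.
  by rewrite !inE.
by rewrite -[w E *+ _]mulr_natl natrX.
Qed.

(** [pick] returns the first element in the enumeration of the type, hence does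
    not change when elements other than the chosen one are removed. *)
Lemma pick_narrow (P Q : pred V) v :
  pick P = Some v -> (forall x, Q x -> P x) -> Q v -> pick Q = Some v.
Proof.
move=> Pv QP Qv; move: Pv; rewrite /pick.
have -> : enum Q = [seq x <- enum P | Q x].
  rewrite /enum_mem -filter_predI; apply: eq_filter => x /=.
  apply/idP/andP => [xQ|[]//]; split => //; exact: QP.
by case: (enum P) => //= x e [->]; rewrite Qv.
Qed.

Section Greedy.
Variables (w : {set V} -> R) (th : {set V} -> R) (beta : R).
Local Notation state := ({set V} * ({set V} -> R))%type.
Implicit Type st : state.

(** A state consists of the vertices selected so far and the weighted sum of
    their links.  A set [A] is saturated when its degree in the latter has
    reached the threshold [th A]; edges containing a saturated set are discarded,
    so that the degree of [A] exceeds its threshold by one link at most. *)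
Definition alive st E : R :=
  if [disjoint E & st.1] &&
     [forall A : {set V}, (A != set0) && (A \subset E) ==> (deg st.2 A < th A)]
  then w E else 0.

Definition candidate I st : pred V :=
  fun v => (v \in I) && (beta <= deg (alive st) [set v]).

Definition select st v : state :=
  (v |: st.1, fun F => st.2 F + link (alive st) v F).

Fixpoint greedy k I st : state :=
  if k is k'.+1 then
    if pick (candidate I st) is Some v then greedy k' I (select st v) else st
  else st.

Hypothesis w_ge0 : forall E, 0 <= w E.
Hypothesis beta_gt0 : 0 < beta.

Lemma alive_ge0 st E : 0 <= alive st E.
Proof. by rewrite /alive; case: ifP. Qed.

Lemma alive_le st E : alive st E <= w E.
Proof. by rewrite /alive; case: ifP. Qed.

Lemma deg_alive_selected st v : v \in st.1 -> deg (alive st) [set v] = 0.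
Proof.
move=> vS; rewrite /deg big1 // => E; rewrite sub1set => vE; rewrite /alive.
case: ifP => // /andP[/pred0P/(_ v)]; by rewrite /= vE vS.
Qed.

Lemma deg_alive_saturated st A :
  A != set0 -> th A <= deg st.2 A -> forall B : {set V}, A \subset B -> deg (alive st) B = 0.
Proof.
move=> A0 thA B AB; rewrite /deg big1 // => E BE; rewrite /alive.
case: ifP => // /andP[_ /forallP/(_ A)].
by rewrite A0 (subset_trans AB BE) /= ltNge thA.
Qed.

Lemma candidateN_selected I st v : candidate I st v -> v \notin st.1.
Proof.
move=> /andP[_ bv]; apply/negP => vS.
by move: bv; rewrite deg_alive_selected // leNgt beta_gt0.
Qed.

Lemma greedy_sub k I st : st.1 \subset (greedy k I st).1.
Proof.
elim: k st => [|k IHk] st //=.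
case: pickP => // v _; apply: (subset_trans _ (IHk _)); exact: subsetUr.
Qed.

(** The procedure inspects its input only by picking the first candidate in it;
    the candidates picked from [I] are all in [J], so they are also the first
    ones in [J]. *)
Lemma greedy_consistent k I J st :
  (greedy k I st).1 \subset J -> J \subset I -> greedy k J st = greedy k I st.
Proof.
elim: k st => [|k IHk] st //= SJ JI; move: SJ.
case eI: (pick (candidate I st)) => [v|] SJ; last first.
  case: pickP => // u /andP[uJ bu]; move: eI; case: pickP => // /(_ u).
  by rewrite /candidate (subsetP JI _ uJ) bu.
have vJ : v \in J.
  by apply: (subsetP SJ); apply: (subsetP (greedy_sub _ _ _)); rewrite setU11.
rewrite (pick_narrow eI); first exact: IHk SJ JI.
  by move=> x /andP[xJ bx]; rewrite /candidate (subsetP JI _ xJ).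
move: eI; case: pickP => // u /andP[_ bu] [uv].
by rewrite /candidate vJ -uv bu.
Qed.

(** A candidate is never an already selected vertex, so the number of steps is
    bounded by the number of unselected vertices. *)
Lemma greedy_stops k I st :
  (#|~: st.1| <= k)%N -> forall v, ~~ candidate I (greedy k I st) v.
Proof.
elim: k st => [|k IHk] st /=.
  rewrite leqn0 cards_eq0 => /eqP S0 v; apply/negP => /candidateN_selected.
  by have := in_set0 v; rewrite -S0 inE => ->.
move=> leSk; case: pickP => [v cv|nc] u; last by rewrite nc.
apply: IHk; rewrite -ltnS; apply: leq_trans leSk; apply: proper_card.
apply/properP; split; first by rewrite setCS subsetUr.
by exists v; rewrite !inE ?eqxx ?(candidateN_selected cv).
Qed.

Variables (s : nat) (U I : {set V}).
Hypothesis w_uniform : forall E, w E != 0 -> #|E| = s.+1 /\ E \subset U.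
Hypothesis w_indep : forall E, E \subset I -> w E = 0.
Hypothesis w_deg : forall v A, A != set0 -> v \notin A -> deg w (v |: A) <= th A.

Definition greedy_inv st :=
  [/\ st.1 \subset I /\ forall F, 0 <= st.2 F,
      forall F, st.2 F != 0 -> #|F| = s /\ F \subset U,
      forall A, A != set0 -> deg st.2 A <= 2 * th A,
      #|st.1|%:R * beta <= mass st.2
    & forall F, F \subset I -> st.2 F = 0].

(** For the degree bound: a saturated set gets nothing from the link of [v], as
    no living edge contains it; an unsaturated one had degree less than [th A]
    and gets at most the degree of [v |: A] in [w], which is at most [th A]. *)
Lemma select_inv st v :
  greedy_inv st -> candidate I st v -> greedy_inv (select st v).
Proof.
move=> [[SI g0] gs gd gm gI] cv; have /andP[vI bv] := cv.
have l0 F : 0 <= link (alive st) v F by rewrite /link; case: ifP; rewrite ?alive_ge0.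
have lF F : link (alive st) v F != 0 -> w (v |: F) != 0 /\ v \notin F.
  rewrite /link; case: ifP; rewrite ?eqxx // => vF.
  by rewrite /alive; case: ifP; rewrite ?eqxx.
split => [|F gF|A A0||F FI] /=.
- split; first by rewrite subUset sub1set vI.
  by move=> F; rewrite addr_ge0.
- have [gF0|] := eqVneq (st.2 F) 0; last exact: gs.
  move: gF; rewrite /= gF0 add0r => /lF[/w_uniform[]].
  move=> cF FU vF; move: cF; rewrite cardsU1 vF add1n => -[->]; split=> //.
  exact: subset_trans (subsetUr _ _) FU.
- rewrite degD deg_link; case: ifP => vA; first by rewrite addr0 gd.
  have [satA|unsatA] := leP (th A) (deg st.2 A).
    by rewrite (deg_alive_saturated A0 satA) ?subsetUr // addr0 gd.
  rewrite mulr2n mulrDl mul1r; apply: lerD; first exact: ltW.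
  by apply: le_trans (w_deg A0 (negbT vA)); apply: ler_deg => E; apply: alive_le.
- rewrite cardsU1 (candidateN_selected cv) natrD mulrDl mul1r addrC.
  rewrite mass_deg0 degD -mass_deg0 deg_link in_set0 setU0.
  exact: lerD.
- rewrite gI // add0r /link; case: ifP => // vF; apply/eqP.
  rewrite eq_le alive_ge0 andbT (le_trans (alive_le _ _)) // w_indep //.
  by rewrite subUset sub1set vI.
Qed.

Lemma greedy_invP k st : greedy_inv st -> greedy_inv (greedy k I st).
Proof.
elim: k st => [|k IHk] st //= ist.
case: pickP => // v cv; exact/IHk/select_inv.
Qed.

End Greedy.
End Weights.

(** * The container theorem *)

Section Containers.
Variable R : realFieldType.

Definition uniform_on (V : finType) (s : nat) (U : {set V}) (w : {set V} -> R) :=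
  forall E, w E != 0 -> #|E| = s /\ E \subset U.

Definition independent (V : finType) (w : {set V} -> R) (I : {set V}) :=
  forall E : {set V}, E \subset I -> w E = 0.

(** The codegree condition: sets of j vertices have degree at most
    K D q^(j-1), where D stands for the average degree.  Both sides are
    multiplied by q to avoid the exponent j-1. *)
Definition spread (V : finType) (K D q : R) (w : {set V} -> R) :=
  forall A, A != set0 -> q * deg w A <= K * D * q ^+ #|A|.

(** In particular [f I = f (S I)]: the fingerprint determines the container.
    Allowing all [J] in between is what makes the property stable when two
    fingerprints are united. *)
Definition reconstructs (V : finType) (X : Type) (S : {set V} -> {set V})
    (f : {set V} -> X) (I : {set V}) :=
  forall J : {set V}, S I \subset J -> J \subset I -> S J = S I /\ f J = f I.

(** [Z I] is a set of at least [d] vertices outside [I] that is computed from a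
    fingerprint of size at most [a]. *)
Definition shrinks (V : finType) (U : {set V}) (a d : R) (S Z : {set V} -> {set V})
    (I : {set V}) :=
  [/\ S I \subset I /\ #|S I|%:R <= a, Z I \subset U, [disjoint Z I & I],
      d <= #|Z I|%:R & reconstructs S Z I].

(** An edge of [w] that is not alive meets the selected set or contains a
    saturated set. *)
Lemma ler_mass_unalive (V : finType) (w th : {set V} -> R)
    (st : {set V} * ({set V} -> R)) :
  (forall E, 0 <= w E) ->
  mass w <= mass (alive w th st) + \sum_(v in st.1) deg w [set v]
     + \sum_(A : {set V} | (A != set0) && (th A <= deg st.2 A)) deg w A.
Proof.
move=> w0.
have d2 (P : pred {set V}) :
    \sum_(A : {set V} | P A) deg w A = \sum_(E : {set V}) \sum_(A : {set V} | P A && (A \subset E)) w E.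
  by rewrite /deg (exchange_big_dep predT).
have d1 : \sum_(v in st.1) deg w [set v] =
    \sum_(E : {set V}) \sum_(v in st.1 | [set v] \subset E) w E.
  by rewrite /deg (exchange_big_dep predT).
rewrite d1 d2 // -!big_split /=; apply: ler_sum => E _.
have s1 : 0 <= \sum_(v in st.1 | [set v] \subset E) w E by exact: sumr_ge0.
have s2 : 0 <= \sum_(A : {set V} | (A != set0) && (th A <= deg st.2 A)
                                   && (A \subset E)) w E by exact: sumr_ge0.
have [dE|] := boolP [disjoint E & st.1]; last first.
  move=> /pred0Pn[v /= /andP[vE vS]].
  have a0 : 0 <= alive w th st E by exact: alive_ge0.
  rewrite (bigD1 v) /=; last by rewrite vS sub1set vE.
  have : 0 <= \sum_(i | (i \in st.1) && ([set i] \subset E) && (i != v)) w E.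
    exact: sumr_ge0.
  by lra.
have [sat|] := boolP [forall A : {set V},
     (A != set0) && (A \subset E) ==> (deg st.2 A < th A)].
  by rewrite {1}/alive dE sat /=; lra.
rewrite negb_forall => /existsP[A]; rewrite negb_imply -leNgt => /andP[/andP[A0 AE] thA].
have a0 : 0 <= alive w th st E by exact: alive_ge0.
rewrite (bigD1 A) /=; last by rewrite A0 thA AE.
have : 0 <= \sum_(B : {set V} | (B != set0) && (th B <= deg st.2 B)
         && (B \subset E) && (B != A)) w E by exact: sumr_ge0.
by lra.
Qed.

(** Induction on the uniformity.  Let g be the accumulated link hypergraph when
    the greedy procedure stops.  Each selected vertex adds at least al/4 D to the
    mass of g, which bounds the fingerprint by the mass of g.  If the mass of g is
    at least al' (q D) n, then g satisfies the hypotheses of the lemma with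
    parameters 2K, al' and qD, and I is independent in g.  Otherwise few edges
    were discarded: q deg w A <= th A <= deg g A for a saturated A, so the mass
    lost to saturation is at most 2^s (mass g) / q, and the edges that meet the
    selected set are few because that set is small.  The remaining edges have mass
    at least al/2 D n, whereas the vertices of degree below al/4 D account for al/4 D n at
    most; hence there are many vertices of degree at least al/4 D, and none of
    them is in I since the procedure has stopped. *)
Lemma container_step s (K alpha : R) : 0 < K -> 0 < alpha ->
  exists b d : R, [/\ 0 < b, 0 < d &
  forall (V : finType) (U : {set V}) (n D q : R) (w : {set V} -> R),
  0 < n -> 0 < D -> 0 < q -> q <= 1 -> #|U|%:R <= n ->
  (forall E, 0 <= w E) -> uniform_on s U w -> spread K D q w ->
  alpha * D * n <= mass w ->
  exists S Z : {set V} -> {set V}, forall I, independent w I ->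
    shrinks U (b * q * n) (d * n) S Z I].
Proof.
elim: s K alpha => [|s IHs] K al K0 al0.
  (* In uniformity 0, independence forces the mass to vanish. *)
  exists 1, 1; split => // V U n D q w n0 D0 q0 q1 Un w0 wU wK wal.
  exists id, id => I wI; exfalso.
  have : 0 < mass w by apply: lt_le_trans wal; rewrite !mulr_gt0.
  rewrite /mass big1 ?ltxx // => E _; apply/eqP/negPn/negP => wE.
  have [/eqP] := wU _ wE; rewrite cards_eq0 => /eqP E0 _.
  by move: wE; rewrite wI ?eqxx // E0 sub0set.
pose P := 2 ^+ s + 4 * K / al.
have P0 : 0 < P by rewrite addr_gt0 ?exprn_gt0 ?divr_gt0 ?mulr_gt0.
(* The edges discarded while g is small have mass at most al' * P * D * n. *)
pose al' := al / 2 / P.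
have al'0 : 0 < al' by rewrite !divr_gt0.
have K20 : 0 < 2 * K by rewrite mulr_gt0.
have [b' [d' [b'0 d'0 IH]]] := IHs (2 * K) al' K20 al'0.
exists (8 * K / al + b'), (Num.min d' (al / (4 * K))); split.
- by rewrite addr_gt0 // divr_gt0 // mulr_gt0.
- by rewrite lt_min d'0 divr_gt0 // mulr_gt0.
move=> V U n D q w n0 D0 q0 q1 Un w0 wU wK wal.
have qD0 : 0 < q * D by rewrite mulr_gt0.
have {}IH g := IH V U n (q * D) q g n0 qD0 q0 q1 Un.
pose th (A : {set V}) := K * D * q ^+ #|A|.
have th0 A : 0 <= th A by rewrite !mulr_ge0 ?exprn_ge0 ?ltW.
pose be := al / 4 * D.
have be0 : 0 < be by rewrite mulr_gt0 // divr_gt0.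
pose fin I := greedy w th be #|V| I (set0, fun=> 0).
have wdeg v A : A != set0 -> v \notin A -> deg w (v |: A) <= th A.
  move=> A0 vA; have vA0 : v |: A != set0 by apply/set0Pn; exists v; rewrite setU11.
  have := wK _ vA0; rewrite cardsU1 vA add1n exprS mulrCA.
  by rewrite ler_pM2l.
have inv I : independent w I -> greedy_inv th be s U I (fin I).
  move=> wI; apply: greedy_invP => //.
  split => //=.
  - by split; [exact: sub0set | move=> _; exact: lexx].
  - by move=> F; rewrite eqxx.
  - by move=> A _; rewrite /deg big1 // mulr_ge0 ?th0.
  - by rewrite cards0 mul0r /mass big1.
have mass_le I : independent w I -> mass (fin I).2 <= n * (2 * K * q * D).
  move=> wI; have [[_ g0] gs gd _ gI] := inv I wI.
  apply: (@le_trans _ _ (\sum_(v in U) deg (fin I).2 [set v])).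
    apply: mass_le_sum_deg => // F gF; split; last by case: (gs _ gF).
    by apply: contraNneq gF => ->; rewrite gI ?sub0set.
  apply: (@le_trans _ _ (\sum_(v in U) 2 * th [set v])).
    by apply: ler_sum => v _; apply: gd; rewrite -cards_eq0 cards1.
  rewrite (eq_bigr (fun=> 2 * K * q * D)); last first.
    by move=> v _; rewrite /th cards1 expr1; ring.
  rewrite sumr_const -[_ *+ _]mulr_natl ler_wpM2r //.
  by rewrite !mulr_ge0 ?ltW.
have /boolp.choice[f fP] (g : {set V} -> R) :
    exists SZ : ({set V} -> {set V}) * ({set V} -> {set V}),
    (forall E, 0 <= g E) -> uniform_on s U g -> spread (2 * K) (q * D) q g ->
    al' * (q * D) * n <= mass g -> forall I, independent g I ->
    shrinks U (b' * q * n) (d' * n) SZ.1 SZ.2 I.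
  case: (pselect [/\ forall E, 0 <= g E, uniform_on s U g, spread (2 * K) (q * D) q g &
     al' * (q * D) * n <= mass g]) => [[h1 h2 h3 h4]|nh].
    by have [S [Z SZ]] := IH g h1 h2 h3 h4; exists (S, Z).
  by exists (id, id) => h1 h2 h3 h4; case: nh.
pose big I := al' * (q * D) * n <= mass (fin I).2.
pose S I := (fin I).1 :|: (if big I then (f (fin I).2).1 I else set0).
pose Z I := if big I then (f (fin I).2).2 I
            else [set v | be <= deg (alive w th (fin I)) [set v]].
have S_le I : independent w I -> #|(fin I).1|%:R <= 8 * K / al * q * n.
  move=> wI; have [_ _ _ cS _] := inv I wI.
  have := le_trans cS (mass_le I wI); rewrite -ler_pdivlMr //.
  move=> h; apply: le_trans h _; rewrite le_eqVlt; apply/orP; left; apply/eqP.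
  by rewrite /be; field; rewrite ?lt0r_neq0.
have min_le c : (Num.min d' (al / (4 * K)) <= c) -> Num.min d' (al / (4 * K)) * n <= c * n.
  by rewrite ler_pM2r.
exists S, Z => I wI; have [[SI g0] gs gd gm gI] := inv I wI.
have fin_rec (J : {set V}) : (fin I).1 \subset J -> J \subset I -> fin J = fin I.
  exact: greedy_consistent.
have [bI|sI] := boolP (big I).
  have gU : uniform_on s U (fin I).2 by exact: gs.
  have gsp : spread (2 * K) (q * D) q (fin I).2.
    move=> A A0; have := gd A A0; rewrite -(ler_pM2l q0) /th => h.
    by apply: le_trans h _; rewrite le_eqVlt; apply/orP; left; apply/eqP; ring.
  have [[S1 S2] Z1 Z2 Z3 rSZ] := fP _ g0 gU gsp bI I gI.
  split.
  - split; first by rewrite /S bI subUset SI.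
    rewrite /S bI; apply: (@le_trans _ _ (#|(fin I).1|%:R + #|(f (fin I).2).1 I|%:R)).
      by rewrite -natrD ler_nat cardsU leq_subr.
    by rewrite (mulrDl _ b') (mulrDl _ _ n); apply: lerD => //; apply: S_le.
  - by rewrite /Z bI.
  - by rewrite /Z bI.
  - by rewrite /Z bI; apply: le_trans Z3; apply: min_le; rewrite ge_min lexx.
  - move=> J SJ JI; move: SJ; rewrite {1}/S bI subUset => /andP[J1 J2].
    have eJ := fin_rec J J1 JI.
    have [eS eZ] := rSZ J J2 JI.
    by rewrite /S /Z /big eJ -/(big I) bI eS eZ.
split.
- rewrite /S (negbTE sI) setU0; split => //; apply: le_trans (S_le _ wI) _.
  by rewrite (mulrDl _ b') (mulrDl _ _ n) lerDl !mulr_ge0 ?ltW.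
- rewrite /Z (negbTE sI); apply/subsetP => v; rewrite inE => bv.
  have : 0 < deg (alive w th (fin I)) [set v] by exact: lt_le_trans bv.
  rewrite lt0r => /andP[dn0 _]; apply/negPn/negP => vU; move/eqP: dn0; apply.
  rewrite /deg big1 // => E; rewrite sub1set => vE.
  rewrite /alive; case: ifP => // _; apply/eqP/negPn/negP => /wU[_ /subsetP/(_ v vE)].
  by rewrite (negbTE vU).
- rewrite /Z (negbTE sI); apply/pred0P => v /=; apply/negbTE/negP => /andP[].
  rewrite inE => bv vI.
  have leV : (#|~: (set0 : {set V})| <= #|V|)%N by rewrite setC0 cardsT.
  have := @greedy_stops _ _ w th be be0 #|V| I (set0, fun=> 0) leV v.
  by rewrite /candidate -/(fin I) vI bv.
- rewrite /Z (negbTE sI).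
  pose a := alive w th (fin I).
  have a0 E : 0 <= a E by exact: alive_ge0.
  have lost : mass w <= mass a + al / 2 * D * n.
    apply: le_trans (ler_mass_unalive th (fin I) w0) _; rewrite -addrA lerD2l.
    rewrite -(ler_pM2l q0).
    have e1 : q * \sum_(v in (fin I).1) deg w [set v] <= 4 * K / al * mass (fin I).2.
      apply: (@le_trans _ _ (q * (#|(fin I).1|%:R * (K * D)))).
        rewrite ler_pM2l // mulr_natl -sumr_const; apply: ler_sum => v _.
        have v0 : [set v] != set0 by rewrite -cards_eq0 cards1.
        by have := wK _ v0; rewrite cards1 expr1 mulrC ler_pM2r.
      apply: (@le_trans _ _ (#|(fin I).1|%:R * (K * D))).
        by rewrite ler_piMl // mulr_ge0 ?ler0n // mulr_ge0 ?ltW.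
      have := gm; rewrite -(ler_pM2l (_ : 0 < 4 * K / al)); last first.
        by rewrite divr_gt0 ?mulr_gt0.
      move=> h; apply: le_trans h.
      rewrite le_eqVlt; apply/orP; left; apply/eqP; rewrite /be.
      by field; rewrite ?lt0r_neq0.
    have e2 : q * \sum_(A : {set V} | (A != set0) && (th A <= deg (fin I).2 A)) deg w A
        <= 2 ^+ s * mass (fin I).2.
      rewrite -(@sum_deg_uniform _ _ (fin I).2); last by move=> E /gs[].
      rewrite mulr_sumr [leLHS]big_mkcond; apply: ler_sum => A _.
      case: ifP => [/andP[A0 thA]|_]; last exact: deg_ge0.
      exact: le_trans (wK _ A0) thA.
    rewrite mulrDr; apply: le_trans (lerD e1 e2) _.
    rewrite -mulrDl addrC -/P.
    move: sI; rewrite /big -ltNge => sI.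
    have := ltW sI; rewrite -(ler_pM2l P0) => h; apply: le_trans h _.
    rewrite le_eqVlt; apply/orP; left; apply/eqP; rewrite /al'.
    by field; rewrite ?lt0r_neq0.
  have aU E : a E != 0 -> E != set0 /\ E \subset U.
    rewrite /a /alive; case: ifP; rewrite ?eqxx // => _ /wU[cE EU]; split => //.
    by rewrite -cards_eq0 cE.
  have := mass_le_sum_deg a0 aU.
  rewrite (bigID (fun v => be <= deg a [set v])) /= => h1.
  have h2 : \sum_(v in U | be <= deg a [set v]) deg a [set v] <=
     #|[set v | be <= deg a [set v]]|%:R * (K * D).
    rewrite mulr_natl -sumr_const [leLHS]big_mkcond [leRHS]big_mkcond /=.
    apply: ler_sum => v _; rewrite inE; case: (be <= _); rewrite ?andbF //.
    rewrite andbT; case: ifP => _; last by rewrite mulr_ge0 ?ltW.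
    apply: le_trans (ler_deg _ (alive_le th w0 (fin I))) _.
    have v0 : [set v] != set0 by rewrite -cards_eq0 cards1.
    by have := wK _ v0; rewrite cards1 expr1 mulrC ler_pM2r.
  have h3 : \sum_(v in U | ~~ (be <= deg a [set v])) deg a [set v] <= n * be.
    apply: (@le_trans _ _ (#|U|%:R * be)); last by rewrite ler_pM2r.
    rewrite mulr_natl -sumr_const [leLHS]big_mkcondr /=; apply: ler_sum => v _.
    by case: (leP be (deg a [set v])) => [_|h] /=; apply: ltW.
  apply: (@le_trans _ _ (al / (4 * K) * n)).
    by apply: min_le; rewrite ge_min lexx orbT.
  rewrite -(ler_pM2r (_ : 0 < K * D)) ?mulr_gt0 //.
  have -> : al / (4 * K) * n * (K * D) = al / 4 * D * n.
    by field; rewrite ?lt0r_neq0.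
  rewrite -/a; move: h3; rewrite /be; move: lost wal h1 h2.
  set x1 := mass w; set x2 := mass a; set x3 := \sum_(v in U | _) _.
  set x4 := #|_|%:R * _; set x5 := \sum_(v in U | ~~ _) _.
  have -> : n * (al / 4 * D) = al / 4 * D * n by ring.
  have -> : al / 2 * D * n = 2 * (al / 4 * D * n) by field.
  have -> : al * D * n = 4 * (al / 4 * D * n) by field.
  by lra.
- move=> J SJ JI; move: SJ; rewrite {1}/S (negbTE sI) setU0 => J1.
  have eJ := fin_rec J J1 JI.
  by rewrite /S /Z /big eJ -/(big I) (negbTE sI).
Qed.

End Containers.

Section Iteration.
Variable R : realType.

Definition restrict (V : finType) (w : {set V} -> R) (C E : {set V}) : R :=
  if E \subset C then w E else 0.

Definition contains_with (V : finType) (U : {set V}) (a : R)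
    (S C : {set V} -> {set V}) (I : {set V}) :=
  [/\ S I \subset I, #|S I|%:R <= a, I \subset C I, C I \subset U
    & reconstructs S C I].

(** As long as the current container carries mass at least alpha D n,
    [container_step] applies to the restricted hypergraph and deletes at least d n
    of its vertices.  This happens fewer than 1/d + 1 times, and the union of the
    fingerprints still determines the successive containers. *)
Lemma containers (r : nat) (K alpha : R) : 0 < K -> 0 < alpha ->
  exists2 b : R, 0 < b &
  forall (V : finType) (U : {set V}) (n D q : R) (w : {set V} -> R),
  0 < n -> 0 < D -> 0 < q -> q <= 1 -> #|U|%:R <= n ->
  (forall E, 0 <= w E) -> uniform_on r U w -> spread K D q w ->
  exists S C : {set V} -> {set V}, forall I : {set V}, I \subset U ->
    independent w I ->
    contains_with U (b * q * n) S C I /\ mass (restrict w (C I)) < alpha * D * n.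
Proof.
move=> K0 al0; have [b [d [b0 d0 step]]] := container_step r K0 al0.
pose k0 := (Num.truncn d^-1).+1.
exists (k0%:R * b); first by rewrite mulr_gt0 // ltr0n.
move=> V U n D q w n0 D0 q0 q1 Un w0 wU wK.
pose small (C : {set V}) := mass (restrict w C) < alpha * D * n.
have /boolp.choice[f fP] (C : {set V}) :
    exists SZ : ({set V} -> {set V}) * ({set V} -> {set V}),
    C \subset U -> ~~ small C -> forall I, independent w I ->
    shrinks C (b * q * n) (d * n) SZ.1 SZ.2 I.
  case CU : (C \subset U); last by exists (id, id).
  case: (boolP (small C)) => [sC|lC]; first by exists (id, id).
  have leC : #|C|%:R <= n by apply: le_trans Un; rewrite ler_nat subset_leq_card.
  have rle E : restrict w C E <= w E by rewrite /restrict; case: ifP.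
  have [||||S [Z SZ]] := step V C n D q (restrict w C) n0 D0 q0 q1 leC.
  - by move=> E; rewrite /restrict; case: ifP.
  - move=> E; rewrite /restrict; case: ifP; rewrite ?eqxx // => EC /wU[]; by split.
  - move=> A A0; apply: le_trans (wK A A0); rewrite ler_pM2l //.
    exact: ler_deg.
  - by rewrite leNgt.
  exists (S, Z) => _ _ I wI; apply: SZ => E EI.
  by rewrite /restrict; case: ifP => // _; apply: wI.
have iter k : exists S C : {set V} -> {set V}, forall I : {set V}, I \subset U ->
    independent w I -> contains_with U (k%:R * b * q * n) S C I /\
    (small (C I) \/ #|C I|%:R <= n - k%:R * d * n).
  elim: k => [|k [S [C IH]]].
    exists (fun=> set0), (fun=> U) => I IU wI; split.
      by split; rewrite ?sub0set ?cards0 ?mul0r // => J _ _.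
    by right; rewrite !mul0r subr0.
  exists (fun I => S I :|: (if small (C I) then set0 else (f (C I)).1 I)),
    (fun I => if small (C I) then C I else C I :\: (f (C I)).2 I) => I IU wI.
  have [[SI cS IC CU rec] SC] := IH I IU wI.
  have kS : k%:R * b * q * n <= k.+1%:R * b * q * n.
    by rewrite !ler_pM2r // ler_nat.
  case: (boolP (small (C I))) => [sC|lC].
    split; last by left.
    split; rewrite ?sC ?setU0 //; first exact: le_trans cS kS.
    move=> J SJ JI; rewrite /= sC setU0 in SJ *.
    by have [eS eC] := rec J SJ JI; rewrite eC sC setU0 eS.
  have [[S1 S2] Z1 Z2 Z3 rSZ] := fP _ CU lC I wI.
  have cZ : #|C I :\: (f (C I)).2 I|%:R = #|C I|%:R - #|(f (C I)).2 I|%:R :> R.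
    by rewrite cardsD (setIidPr Z1) natrB // subset_leq_card.
  split; last first.
    right; case: SC => [sC|SC]; first by rewrite sC in lC.
    by rewrite cZ (_ : k.+1%:R * d * n = k%:R * d * n + d * n); [lra|rewrite -natr1; ring].
  split; rewrite ?(negbTE lC).
  - by rewrite subUset SI.
  - apply: (@le_trans _ _ (#|S I|%:R + #|(f (C I)).1 I|%:R)).
      by rewrite -natrD ler_nat cardsU leq_subr.
    by rewrite (_ : k.+1%:R * b * q * n = k%:R * b * q * n + b * q * n);
      [exact: lerD | rewrite -natr1; ring].
  - by rewrite subsetD IC disjoint_sym.
  - exact: subset_trans (subsetDl _ _) CU.
  - move=> J; rewrite (negbTE lC) subUset => /andP[J1 J2] JI.
    have [eS eC] := rec J J1 JI; have [eS' eZ'] := rSZ J J2 JI.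
    by rewrite eC (negbTE lC) eS eS' eZ'.
have [S [C SC]] := iter k0; exists S, C => I IU wI.
have [IC [//|cC]] := SC I IU wI; exfalso.
have : k0%:R * d > 1.
  rewrite -(ltr_pdivrMr _ _ d0) div1r.
  have := @truncnS_gt R d^-1; exact.
rewrite -(ltr_pM2r n0) mul1r => h.
have : 0 <= #|C I|%:R :> R by [].
by lra.
Qed.

End Iteration.

(** * Injections and pullbacks of families of l-sets *)

Section Maps.

(** The elements outside [W] are matched with elements of [Y] outside [f @: W] by
    their ranks in the two enumerations. *)
Lemma extend_injection (T U : finType) (W : {set T}) (Y : {set U}) (f : T -> U) :
  {in W &, injective f} -> f @: W \subset Y -> (#|T| <= #|Y|)%N ->
  exists g : {ffun T -> U},
    [/\ injective g, {in W, g =1 f} & forall x, g x \in Y].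
Proof.
move=> fI fWY TY.
pose r := enum (~: W); pose z := enum (Y :\: f @: W).
have szrz : (size r <= size z)%N.
  rewrite -!cardE cardsD (setIidPr fWY) card_in_imset //.
  by rewrite cardsCs setCK leq_sub2r.
have idx x : x \notin W -> (index x r < size r)%N.
  by move=> xW; rewrite index_mem mem_enum inE.
have nz x : x \notin W -> nth (f x) z (index x r) \in Y :\: f @: W.
  by move=> xW; rewrite -mem_enum; apply: mem_nth; apply: leq_trans (idx _ xW) szrz.
exists [ffun x => if x \in W then f x else nth (f x) z (index x r)]; split.
- move=> x y; rewrite !ffunE; case: ifPn => xW; case: ifPn => yW.
  + exact: fI.
  + by move=> e; have := nz _ yW; rewrite -e inE imset_f.
  + by move=> e; have := nz _ xW; rewrite e inE imset_f.
  + rewrite (set_nth_default (f y)) ?(leq_trans (idx _ xW)) // => /eqP.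
    rewrite nth_uniq ?enum_uniq ?(leq_trans (idx _ _) szrz) // => /eqP e.
    rewrite -(@nth_index _ x x r) ?mem_enum ?inE // e nth_index ?mem_enum ?inE //.
- by move=> x xW; rewrite ffunE xW.
- move=> x; rewrite ffunE; case: ifPn => xW; first by apply: (subsetP fWY); rewrite imset_f.
  by have := nz _ xW; rewrite inE => /andP[].
Qed.

Lemma leq_card_family (T U : finType) (W : {set T}) (a : nat) (F : T -> {set U}) :
  (forall x, x \in W -> (#|F x| <= a)%N) ->
  (#|[set f : {ffun T -> U} | [forall x, f x \in F x]]| <= a ^ #|W| * #|U| ^ (#|T| - #|W|))%N.
Proof.
move=> Fa.
have -> : #|[set f : {ffun T -> U} | [forall x, f x \in F x]]| = #|family (fun x => mem (F x))|.
  by apply: eq_card => f; rewrite inE; apply/forallP/familyP.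
rewrite card_family foldrE big_image /= (bigID (mem W)) /=.
rewrite leq_mul //.
  by rewrite -prod_nat_const; apply: leq_prod.
have -> : (#|T| - #|W| = #|~: W|)%N by rewrite [RHS]cardsCs setCK.
rewrite -prod_nat_const.
rewrite [leqRHS](eq_bigl (fun x => x \notin W)) => [|x]; last by rewrite inE.
by apply: leq_prod => x _; apply: max_card.
Qed.

(** Swapping an element of [A] outside [B] with one of [B] outside [A] brings
    [A] closer to [B]. *)
Lemma perm_moving_set (U : finType) (A B : {set U}) :
  #|A| = #|B| -> exists s : {perm U}, s @: A = B.
Proof.
move: {2}#|A :\: B| (leqnn #|A :\: B|) => k.
elim: k A => [|k IHk] A.
  rewrite leqn0 cards_eq0 setD_eq0 => AB cAB; exists 1%g.
  rewrite (eq_imset _ (@perm1 _)) imset_id.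
  by apply/eqP; rewrite eqEcard AB cAB leqnn.
move=> leAB cAB; have [D0|[a /setDP[aA aB]]] := set_0Vmem (A :\: B).
  by apply: IHk => //; rewrite D0 cards0 leq0n.
have [b /setDP[bB bA]] : exists b, b \in B :\: A.
  apply/set0Pn; rewrite -card_gt0 cardsD setIC -cAB -cardsD card_gt0.
  by apply/set0Pn; exists a; rewrite inE aA aB.
have tA : tperm a b @: A = b |: (A :\ a).
  apply/setP => x; rewrite !inE; apply/imsetP/idP => [[y yA ->]|].
    case: tpermP => [_|yb|/eqP ya /eqP yb]; rewrite ?eqxx //.
      by rewrite -yb yA in bA.
    by rewrite ya yA orbT.
  move=> /orP[/eqP->|/andP[xa xA]]; first by exists a; rewrite ?tpermL.
  exists x => //; rewrite tpermD // 1?eq_sym //.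
  by apply: contraNneq bA => <-.
have [||s sB] := IHk (tperm a b @: A).
- rewrite -ltnS (leq_trans _ leAB) // tA; apply: proper_card.
  apply/properP; split.
    apply/subsetP => x; rewrite !inE => /andP[xB /orP[/eqP xb|/andP[_ ->]]].
      by rewrite xb bB in xB.
    by rewrite xB.
  by exists a; rewrite !inE ?aA ?aB // eqxx /= orbF; apply: contraNneq aB => ->.
- by rewrite card_imset //; apply: perm_inj.
exists (tperm a b * s)%g; rewrite -sB -imset_comp.
by apply: eq_imset => x; rewrite permM.
Qed.

Definition injections (m N : nat) : {set {ffun 'I_m -> 'I_N}} :=
  [set f : {ffun 'I_m -> 'I_N} | injectiveb f].

Lemma card_injections m N : #|injections m N| = N ^_ m.
Proof.
rewrite /injections -[N in RHS]card_ord -[m in RHS]card_ord -card_inj_ffuns.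
by apply: eq_card => f; rewrite !inE.
Qed.

Definition lsets (l N : nat) : {set {set 'I_N}} := [set e : {set 'I_N} | #|e| == l].

Lemma card_lsets l N : #|lsets l N| = 'C(N, l).
Proof. by rewrite /lsets card_draws card_ord. Qed.

Definition pullback (l m N : nat) (C : {set {set 'I_N}}) (f : 'I_m -> 'I_N)
    : {set {set 'I_m}} :=
  [set e in lsets l m | f @: e \in C].

(** By symmetry, the number of injections carrying [e] onto [A] is the same for
    all l-subsets [A]. *)
Lemma card_injections_onto l m N (e : {set 'I_m}) (A : {set 'I_N}) :
  #|e| = l -> #|A| = l ->
  (#|[set f in injections m N | f @: e == A]| * 'C(N, l) = N ^_ m)%N.
Proof.
move=> el Al.
have same (B : {set 'I_N}) : #|B| = l -> #|[set f in injections m N | f @: e == B]| =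
                          #|[set f in injections m N | f @: e == A]|.
  suff le (B1 B2 : {set 'I_N}) : #|B1| = l -> #|B2| = l ->
     (#|[set f in injections m N | f @: e == B1]| <=
        #|[set f in injections m N | f @: e == B2]|)%N.
    by move=> Bl; apply/eqP; rewrite eqn_leq !le.
  move=> l1 l2; have [s sB] : exists s : {perm 'I_N}, s @: B1 = B2.
    by apply: perm_moving_set; rewrite l1.
  pose h (f : {ffun 'I_m -> 'I_N}) := [ffun x => s (f x)].
  have hI : injective h.
    move=> f g /ffunP fg; apply/ffunP => x; have := fg x; rewrite !ffunE.
    exact: perm_inj.
  rewrite -(card_imset _ hI); apply/subset_leq_card/subsetP => _ /imsetP[f + ->].
  rewrite !inE => /andP[/injectiveP fI /eqP fe]; apply/andP; split.
    by apply/injectiveP => x y; rewrite !ffunE => /perm_inj/fI.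
  rewrite -sB -fe -imset_comp; apply/eqP.
  by apply: eq_imset => x; rewrite ffunE.
rewrite -card_injections -card_lsets mulnC -sum_nat_const.
rewrite -[RHS]sum1_card (partition_big (fun f : {ffun _} => f @: e) (mem (lsets l N))) /=.
  apply: eq_bigr => B; rewrite inE => /eqP Bl; rewrite -(same _ Bl) -sum1_card.
  by apply: eq_bigl => f; rewrite !inE.
by move=> f; rewrite !inE => /injectiveP fI; rewrite card_imset // el.
Qed.

(** Averaging: under a random injection the expected density of the pullback is
    the density of [C]. *)
Lemma sum_card_pullback l m N (C : {set {set 'I_N}}) : C \subset lsets l N ->
  ((\sum_(f in injections m N) #|pullback l C f|) * 'C(N, l)
     = #|C| * N ^_ m * 'C(m, l))%N.
Proof.
move=> Cl.
have -> : (\sum_(f in injections m N) #|pullback l C f| =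
   \sum_(e in lsets l m) \sum_(A in C) #|[set f in injections m N | f @: e == A]|)%N.
  under eq_bigr do rewrite -sum1_card.
  rewrite (exchange_big_dep (mem (lsets l m))) /=; last first.
    by move=> f e _; rewrite inE => /andP[].
  apply: eq_bigr => e el.
  rewrite (partition_big (fun f : {ffun _} => f @: e) (mem C)) /=.
    apply: eq_bigr => A AC; rewrite -sum1_card; apply: eq_bigl => f.
    move: el; rewrite !inE => ->.
    by case: (_ =P A) => [->|_]; rewrite ?AC ?andbT ?andbF.
  by move=> f; rewrite inE => /andP[_]; rewrite inE => /andP[].
rewrite big_distrl /= (eq_bigr (fun=> #|C| * N ^_ m))%N.
  by rewrite sum_nat_const card_lsets mulnC.
move=> e; rewrite inE => /eqP el; rewrite big_distrl /=.
rewrite (eq_bigr (fun=> N ^_ m)) ?sum_nat_const // => A AC.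
apply: card_injections_onto => //.
by have := subsetP Cl _ AC; rewrite inE => /eqP.
Qed.

Lemma expn_leq_ffact m N : (2 * m <= N)%N -> (N ^ m <= 2 ^ m * N ^_ m)%N.
Proof.
move=> mN; rewrite ffact_prod -[m in (2 ^ m)%N]card_ord -prod_nat_const.
rewrite -[m in (N ^ m)%N]card_ord -prod_nat_const -big_split /=.
apply: leq_prod => i _; have := ltn_ord i; lia.
Qed.

End Maps.

(** * Copies of H and the Turán density *)

Section Copies.
Variables (l : nat) (T : finType) (H : lgraph l T).

Lemma edges_lgraph (U : finType) (G : lgraph l U) e :
  e \in edges G -> e \subset verts G /\ #|e| = l.
Proof.
rewrite /edges /verts; case: G => VE /= /forallP/(_ e)/implyP eG /eG.
by move=> /andP[eV /eqP].
Qed.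

(** The maps are injective on the whole ambient type [T].  Its elements outside
    the vertex set of [H] behave like isolated vertices, which affects neither
    the freeness of graphs with at least [#|T|] vertices nor m(H). *)
Definition copies (N : nat) (C : {set {set 'I_N}}) : {set {ffun T -> 'I_N}} :=
  [set f : {ffun T -> 'I_N} | injectiveb f & [forall e in edges H, f @: e \in C]].

Lemma copiesP (N : nat) (C : {set {set 'I_N}}) (f : {ffun T -> 'I_N}) :
  reflect (injective f /\ forall e : {set T}, e \in edges H -> f @: e \in C) (f \in copies C).
Proof.
rewrite inE; apply: (iffP andP) => -[/injectiveP fI fC]; split => //.
  by move=> e; exact/implyP/(forallP fC).
by apply/forallP => e; apply/implyP/fC.
Qed.

(** The edges of [H] alone decide which vertices are constrained: a map that
    carries them into [edges G] is modified outside their union so as to take its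
    values in [verts G], where there is room by hypothesis; conversely, an
    isomorphism onto a subgraph is extended to an injection of [T]. *)
Lemma free_copies (N : nat) (G : lgraph l 'I_N) : (#|T| <= #|verts G|)%N ->
  is_free H G = (copies (edges G) == set0).
Proof.
move=> TG; apply/idP/idP; last first.
  move=> cG; apply/negP => /existsP[F /andP[/andP[FG1 FG2]]].
  move=> /existsP[f /and3P[/forallP fI /eqP fV /eqP fE]].
  have fI' : {in verts H &, injective f}.
    move=> x y xH yH fxy; have /implyP/(_ xH)/forallP/(_ y) := fI x.
    by rewrite yH fxy eqxx /= => /eqP.
  have [||g [gI gf _]] := extend_injection (Y := setT) fI'.
  - exact: subsetT.
  - exact: leq_trans TG (subset_leq_card (subsetT _)).
  have : g \in copies (edges G); last by rewrite (eqP cG) in_set0.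
  apply/copiesP; split => // e eH.
  have [eV _] := edges_lgraph eH.
  have -> : g @: e = f @: e.
    by apply: eq_in_imset => x xe; apply: gf; apply: (subsetP eV).
  by apply: (subsetP FG2); rewrite -fE; apply/imsetP; exists e.
move=> frG; apply/set0Pn => -[f /copiesP[fI fG]]; move/negP: frG; apply.
pose W := cover (edges H).
have fWG : f @: W \subset verts G.
  apply/subsetP => _ /imsetP[x /bigcupP[e eH xe] ->].
  have [feG _] := edges_lgraph (fG e eH).
  by apply: (subsetP feG); rewrite imset_f.
have fIW : {in W &, injective f} by move=> x y _ _; apply: fI.
have [g [gI gf gG]] := extend_injection fIW fWG TG.
have gfe (e : {set T}) : e \in edges H -> g @: e = f @: e.
  move=> eH; apply: eq_in_imset => x xe; apply: gf.
  by apply/bigcupP; exists e.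
have Fl : is_lgraph l (g @: verts H, [set g @: (e : {set T}) | e in edges H]).
  apply/forallP => e; apply/implyP => /imsetP[e' e'H ->] /=.
  have [e'V e'l] := edges_lgraph e'H.
  by rewrite imsetS // card_imset // e'l eqxx.
apply/existsP; exists (LGraph Fl); apply/andP; split.
  apply/andP; split; apply/subsetP => x /imsetP[y yH ->] //.
  by rewrite gfe // fG.
apply/existsP; exists g; apply/and3P; split => //.
by apply/forallP => x; apply/implyP => _; apply/forallP => y; apply/implyP => _;
  apply/implyP => /eqP/gI ->.
Qed.

Lemma is_lgraph_lsets (N : nat) (C : {set {set 'I_N}}) :
  is_lgraph l ([set: 'I_N], C :&: lsets l N).
Proof.
apply/forallP => e; apply/implyP; rewrite !inE /= => /andP[_ ->].
by rewrite subsetT.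
Qed.

Definition spanning (N : nat) (C : {set {set 'I_N}}) : lgraph l 'I_N :=
  LGraph (is_lgraph_lsets C).

Lemma copies_free_leq_ex (N : nat) (C : {set {set 'I_N}}) :
  (#|T| <= N)%N -> C \subset lsets l N -> copies C = set0 ->
  (#|C| <= ex_number N H)%N.
Proof.
move=> TN Cl C0; have eC : edges (spanning C) = C by rewrite /edges /= (setIidPl Cl).
rewrite -{1}eC; apply: (leq_bigmax_cond (spanning C)).
by rewrite /verts eqxx /= free_copies ?eC ?C0 // /verts /= cardsT card_ord.
Qed.

Lemma ex_number_leq (N x : nat) : (#|T| <= N)%N ->
  (forall C : {set {set 'I_N}}, C \subset lsets l N -> copies C = set0 -> (#|C| <= x)%N) ->
  (ex_number N H <= x)%N.
Proof.
move=> TN Cx; apply/bigmax_leqP => G /andP[/eqP VG fG]; apply: Cx.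
  by apply/subsetP => e /edges_lgraph[_ el]; rewrite inE el.
by apply/eqP; rewrite -free_copies // VG cardsT card_ord.
Qed.

Lemma copies_pullback (m N : nat) (C : {set {set 'I_N}}) (f : {ffun 'I_m -> 'I_N})
    (h : {ffun T -> 'I_m}) :
  f \in injections m N -> h \in copies (pullback l C f) ->
  [ffun x => f (h x)] \in copies C.
Proof.
rewrite inE => /injectiveP fI /copiesP[hI hC]; apply/copiesP; split.
  by move=> x y; rewrite !ffunE => /fI/hI.
move=> e eH; have := hC e eH; rewrite inE => /andP[_].
rewrite -imset_comp; congr (_ \in C).
by apply: eq_imset => x; rewrite ffunE.
Qed.

(** All pullbacks of an [H]-free family along injections are [H]-free; average
    their sizes. *)
Lemma ex_density_nonincreasing (m N : nat) : (#|T| <= m <= N)%N -> (l <= m)%N ->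
  (ex_number N H * 'C(m, l) <= ex_number m H * 'C(N, l))%N.
Proof.
move=> /andP[Tm mN] lm; rewrite -leq_divRL ?bin_gt0 //.
apply: ex_number_leq; first exact: leq_trans Tm mN.
move=> C Cl C0; rewrite leq_divRL ?bin_gt0 //.
have N0 : (0 < N ^_ m)%N by rewrite ffact_gt0.
rewrite -(leq_pmul2l N0) mulnA [(N ^_ m * _)%N]mulnC -sum_card_pullback // mulnA.
rewrite leq_mul2r -[(N ^_ m)%N]card_injections -sum_nat_const; apply/orP; right.
apply: leq_sum => f fI; apply: copies_free_leq_ex => //.
  by apply/subsetP => e; rewrite inE => /andP[].
apply/eqP/set0Pn => -[h /(copies_pullback fI)].
by rewrite C0 in_set0.
Qed.

Lemma card_comp_fiber (m N : nat) (h : {ffun T -> 'I_m}) (g : {ffun T -> 'I_N}) :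
  injective h ->
  (#|[set f : {ffun 'I_m -> 'I_N} | [ffun x => f (h x)] == g]| <= N ^ (m - #|T|))%N.
Proof.
move=> hI.
pose W := [set y in codom h].
have cW : #|W| = #|T| by rewrite cardsE card_codom.
pose F (y : 'I_m) : {set 'I_N} := [set z | [forall x, (h x == y) ==> (g x == z)]].
have := @leq_card_family _ _ W 1 F _.
rewrite exp1n mul1n !card_ord cW => le.
apply: leq_trans (le _); first apply: subset_leq_card.
  apply/subsetP => f; rewrite !inE => /eqP fg; apply/forallP => y; rewrite inE.
  by apply/forallP => x; apply/implyP => /eqP <-; rewrite -fg ffunE.
move=> y; rewrite inE => /codomP[x yx]; rewrite -(cards1 (g x)).
apply: subset_leq_card; apply/subsetP => z; rewrite !inE => /forallP/(_ x).
by rewrite yx eqxx /= => /eqP->.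
Qed.

(** A pullback with more than [ex_number m H] elements contains a copy of [H].
    Composing it with the injection gives a copy in [C], and a given copy in [C]
    arises from at most m^|T| N^(m - |T|) pairs. *)
Lemma supersaturation_count (m N : nat) (C : {set {set 'I_N}}) :
  (#|T| <= m)%N -> C \subset lsets l N ->
  (#|C| * N ^_ m * 'C(m, l) <=
   (N ^_ m * ex_number m H + 'C(m, l) * (m ^ #|T| * (#|copies C| * N ^ (m - #|T|)))) * 'C(N, l))%N.
Proof.
move=> Tm Cl; rewrite -sum_card_pullback // leq_mul2r; apply/orP; right.
apply: (@leq_trans (\sum_(f in injections m N)
   (ex_number m H + 'C(m, l) * #|copies (pullback l C f)|))%N).
  apply: leq_sum => f fI.
  have pl : pullback l C f \subset lsets l m by apply/subsetP => e; rewrite inE => /andP[].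
  have [p0|/set0Pn pn] := eqVneq (copies (pullback l C f)) set0.
    by rewrite p0 cards0 muln0 addn0 copies_free_leq_ex.
  have : (0 < #|copies (pullback l C f)|)%N by rewrite card_gt0; apply/set0Pn.
  have := subset_leq_card pl; rewrite card_lsets; nia.
rewrite big_split /= sum_nat_const card_injections leq_add2l -big_distrr /=.
rewrite leq_mul2l; apply/orP; right.
pose inj := [set h : {ffun T -> 'I_m} | injectiveb h].
apply: (@leq_trans (\sum_(f : {ffun 'I_m -> 'I_N}) \sum_(h in inj) \sum_(g in copies C)
   ([ffun x => f (h x)] == g))%N).
  rewrite big_mkcond /=; apply: leq_sum => f _; case: ifP => // fI.
  rewrite -sum1_card big_mkcond [leqRHS]big_mkcond /=; apply: leq_sum => h _.
  case: ifP => // hC; have /copiesP[hI _] := hC.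
  rewrite inE (introT (injectiveP _) hI) (bigD1 [ffun x => f (h x)]) ?eqxx //=.
  exact: (copies_pullback fI).
rewrite exchange_big /=.
apply: (@leq_trans (\sum_(h in inj) #|copies C| * N ^ (m - #|T|))%N).
  apply: leq_sum => h; rewrite inE => /injectiveP hI.
  rewrite exchange_big /= -sum_nat_const; apply: leq_sum => g _.
  apply: leq_trans (card_comp_fiber g hI).
  rewrite -sum1_card [leqRHS]big_mkcond /=; apply: leq_sum => f _.
  by rewrite inE; case: eqP.
rewrite sum_nat_const leq_mul2r; apply/orP; right.
apply: leq_trans (max_card _) _; by rewrite card_ffun card_ord.
Qed.

End Copies.

Section TuranDensity.
Variables (R : realType) (l : nat) (T : finType) (H : lgraph l T).

Let density (N : nat) : R := (ex_number N H)%:R / 'C(N, l)%:R.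

(** The density is nonincreasing only from [maxn #|T| l] on. *)
Lemma turan_density_cvg : cvgn density.
Proof.
pose k := maxn #|T| l.
suff : cvgn [sequence density (n + k)%N]_n.
  by move=> /cvg_ex[a]; rewrite cvg_shiftn => ?; apply/cvg_ex; exists a.
apply: nonincreasing_is_cvgn.
  move=> m n mn /=.
  have Tk i : (#|T| <= i + k)%N by rewrite (leq_trans (leq_maxl _ l)) // leq_addl.
  have lk i : (l <= i + k)%N by rewrite (leq_trans (leq_maxr #|T| l)) // leq_addl.
  rewrite /density ler_pdivrMr ?ltr0n ?bin_gt0 // mulrAC ler_pdivlMr ?ltr0n ?bin_gt0 //.
  by rewrite -!natrM ler_nat ex_density_nonincreasing // Tk leq_add2r.
by exists 0 => _ [n _ <-]; rewrite /= divr_ge0.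
Qed.

Lemma turan_density_ge0 : 0 <= turan_density R H.
Proof. by apply: limr_ge; [exact: turan_density_cvg | near=> n; rewrite divr_ge0]. Unshelve. all: by end_near. Qed.

Lemma turan_density_approx (eps : R) (m0 : nat) : 0 < eps ->
  exists2 m, (m0 <= m)%N &
    (ex_number m H)%:R <= (turan_density R H + eps) * 'C(m, l)%:R.
Proof.
move=> e0.
have lt : turan_density R H < turan_density R H + eps by rewrite ltrDl.
have [m _ mP] := cvgr_le _ turan_density_cvg _ lt.
pose k := maxn m (maxn m0 l); exists k.
  by rewrite /k !leq_max leqnn orbT.
have lk : (l <= k)%N by rewrite /k !leq_max leqnn !orbT.
rewrite -ler_pdivrMr ?ltr0n ?bin_gt0 //; apply: mP.
by rewrite /= /k leq_max leqnn.
Qed.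

(** Fix m with ex(m,H)/C(m,l) <= pi(H) + eps/2 and apply
    [supersaturation_count] with this m, as N tends to infinity. *)
Lemma supersaturation (eps : R) : 0 < eps ->
  exists2 a : R, 0 < a & exists N0 : nat, forall N : nat, (N0 <= N)%N ->
    forall C : {set {set 'I_N}}, C \subset lsets l N ->
    (turan_density R H + eps) * 'C(N, l)%:R <= #|C|%:R ->
    a * N%:R ^+ #|T| <= #|copies H C|%:R.
Proof.
move=> e0; have e20 : 0 < eps / 2 by rewrite divr_gt0.
have [m mTl exm] := turan_density_approx (maxn #|T| l).+1 e20.
have [Tm lm] : (#|T| <= m /\ l <= m)%N.
  by split; apply: ltnW; apply: leq_trans mTl; rewrite ltnS leq_max leqnn ?orbT.
have m0 : (0 < m)%N by apply: leq_trans mTl.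
exists (eps / 2 / (2 ^+ m * m%:R ^+ #|T|)).
  by rewrite divr_gt0 // mulr_gt0 // exprn_gt0 // ltr0n.
exists (2 * m)%N => N mN C Cl Cbig.
have N0 : (0 < N)%N by apply: leq_trans mN; rewrite muln_gt0.
have lN : (l <= N)%N by apply: leq_trans lm _; lia.
have CN : 0 < 'C(N, l)%:R :> R by rewrite ltr0n bin_gt0.
have Cm : 0 < 'C(m, l)%:R :> R by rewrite ltr0n bin_gt0.
have := supersaturation_count H Tm Cl.
rewrite -(ler_nat R) !(natrM, natrD, natrX).
set pi := turan_density R H in exm Cbig *.
set f := (N ^_ m)%:R; set X := #|copies H C|%:R; set cN := 'C(N, l)%:R.
set cm := 'C(m, l)%:R; set tm := m%:R ^+ #|T|; set Nm := N%:R ^+ (m - #|T|).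
move=> h.
have f0 : 0 < f by rewrite ltr0n ffact_gt0; lia.
have h1 : (pi + eps) * cN * f * cm <= (f * ((pi + eps / 2) * cm) + cm * (tm * (X * Nm))) * cN.
  apply: le_trans (le_trans _ h) _.
    by rewrite !ler_pM2r.
  by rewrite ler_pM2r // lerD2r ler_pM2l.
have h2 : eps / 2 * f <= tm * (X * Nm).
  rewrite -(ler_pM2r CN) -(ler_pM2r Cm) -/cN -/cm.
  have -> : eps / 2 * f * cN * cm = (pi + eps) * cN * f * cm - f * ((pi + eps / 2) * cm) * cN.
    by field.
  by rewrite lerBlDl; apply: le_trans h1 _; rewrite le_eqVlt; apply/orP; left; apply/eqP; ring.
have h3 : N%:R ^+ m <= 2 ^+ m * f.
  by rewrite /f -!natrX -natrM ler_nat; apply: expn_leq_ffact.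
have tm0 : 0 < tm by rewrite exprn_gt0 // ltr0n.
have Nm0 : 0 < Nm by rewrite exprn_gt0 // ltr0n.
have p0 : 0 < 2 ^+ m :> R by rewrite exprn_gt0.
rewrite -mulrA mulrCA mulrC ler_pdivrMr ?mulr_gt0 //.
rewrite -(ler_pM2r Nm0) -[leLHS]mulrA -exprD subnKC // .
apply: (@le_trans _ _ (eps / 2 * (2 ^+ m * f))); first by rewrite ler_pM2l.
rewrite mulrCA; have := h2; rewrite -(ler_pM2l p0) => h4; apply: le_trans h4 _.
by rewrite le_eqVlt; apply/orP; left; apply/eqP; ring.
Qed.

End TuranDensity.

(** * The hypergraph of copies of H and its codegrees *)

Section CopyHypergraph.
Variables (R : realType) (l : nat) (T : finType) (H : lgraph l T).

Definition copy_weight (N : nat) (E : {set {set 'I_N}}) : R :=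
  #|[set f : {ffun T -> 'I_N} | injectiveb f &
       [set f @: (e : {set T}) | e in edges H] == E]|%:R.

Lemma sum_copy_weight (N : nat) (P : pred {set {set 'I_N}}) :
  \sum_(E | P E) copy_weight E =
  #|[set f : {ffun T -> 'I_N} | injectiveb f &
       P [set f @: (e : {set T}) | e in edges H]]|%:R.
Proof.
rewrite -sum1_card (partition_big (fun f : {ffun T -> 'I_N} =>
    [set f @: (e : {set T}) | e in edges H]) P) /=; last first.
  by move=> f; rewrite inE => /andP[].
rewrite natr_sum; apply: eq_bigr => E PE; rewrite /copy_weight -sum1_card.
congr (_%:R); apply: eq_bigl => f; rewrite !inE.
by case: (_ =P E) => [->|_]; rewrite ?PE ?andbF ?andbT.
Qed.

Lemma copy_weight_neq0 (N : nat) (E : {set {set 'I_N}}) : copy_weight E != 0 ->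
  exists2 f : {ffun T -> 'I_N}, injective f &
    E = [set f @: (e : {set T}) | e in edges H].
Proof.
rewrite pnatr_eq0 cards_eq0 => /set0Pn[f]; rewrite inE => /andP[/injectiveP fI /eqP <-].
by exists f.
Qed.

Lemma copy_weight_uniform (N : nat) :
  uniform_on (nedges H) (lsets l N) (@copy_weight N).
Proof.
move=> E /copy_weight_neq0[f fI ->]; split.
  by rewrite card_imset //; apply: imset_inj.
apply/subsetP => _ /imsetP[e eH ->]; have [_ el] := edges_lgraph eH.
by rewrite inE card_imset // el.
Qed.

Lemma copy_weight_independent (N : nat) (I : {set {set 'I_N}}) :
  copies H I = set0 -> independent (@copy_weight N) I.
Proof.
move=> I0 E EI; apply/eqP/negPn/negP => /copy_weight_neq0[f fI Ef].
have : f \in copies H I; last by rewrite I0 in_set0.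
apply/copiesP; split => // e eH; apply: (subsetP EI).
by rewrite Ef; apply/imsetP; exists e.
Qed.

Lemma mass_restrict_copy_weight (N : nat) (C : {set {set 'I_N}}) :
  mass (restrict (@copy_weight N) C) = #|copies H C|%:R.
Proof.
rewrite /mass /restrict -big_mkcond /= sum_copy_weight; congr (_%:R).
apply: eq_card => f; rewrite inE; apply/andP/copiesP.
  move=> [/injectiveP fI /subsetP fC]; split => // e eH; apply: fC.
  by apply/imsetP; exists e.
move=> [fI fC]; split; first exact/injectiveP.
by apply/subsetP => _ /imsetP[e eH ->]; apply: fC.
Qed.

(** Such a map carries [cover J] into [cover A], a set of the same size, and is
    unconstrained elsewhere. *)
Lemma card_copies_onto (N : nat) (J : {set {set T}}) (A : {set {set 'I_N}}) :
  (#|[set f : {ffun T -> 'I_N} | injectiveb f &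
        [set f @: (e : {set T}) | e in J] == A]|
     <= #|T| ^ #|T| * N ^ (#|T| - #|cover J|))%N.
Proof.
set X := [set f | _ & _]; have [->|/set0Pn[g]] := eqVneq X set0; first by rewrite cards0.
rewrite inE => /andP[/injectiveP gI /eqP gJ].
have cov (f : {ffun T -> 'I_N}) : [set f @: (e : {set T}) | e in J] = A ->
    f @: cover J = cover A.
  by move=> <-; rewrite cover_imset -imset_cover.
have cA : #|cover A| = #|cover J| by rewrite -(cov _ gJ) card_imset.
pose F x : {set 'I_N} := if x \in cover J then cover A else setT.
have := @leq_card_family _ _ (cover J) #|cover A| F _.
rewrite card_ord => le; apply: leq_trans (leq_trans (le _) _).
- apply/subset_leq_card/subsetP => f; rewrite !inE => /andP[_ /eqP fJ].
  apply/forallP => x; rewrite /F; case: ifP => // xJ.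
  by rewrite -(cov _ fJ) imset_f.
- by move=> x xJ; rewrite /F xJ leqnn.
rewrite leq_mul2r cA; apply/orP; right.
have cT : (#|cover J| <= #|T|)%N by apply: max_card.
have [->|c0] := posnP #|cover J|; first by rewrite expn0; case: #|T| => // n; rewrite expn_gt0.
apply: (@leq_trans (#|T| ^ #|cover J|)); first by rewrite leq_exp2r.
by rewrite leq_pexp2l // (leq_trans c0).
Qed.

(** A map whose copy contains [A] carries exactly one set [J] of edges of [H]
    onto [A]. *)
Lemma codegree_bound (N : nat) (A : {set {set 'I_N}}) :
  deg (@copy_weight N) A <=
  \sum_(J : {set {set T}} | (J \subset edges H) && (#|J| == #|A|))
     (#|T| ^ #|T| * N ^ (#|T| - #|cover J|))%:R.
Proof.
rewrite /deg sum_copy_weight -natr_sum ler_nat.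
apply: leq_trans (leq_sum _ (fun J _ => @card_copies_onto N J A)).
rewrite -sum1_card; under [leqRHS]eq_bigr do rewrite -sum1_card.
rewrite [leqRHS](exchange_big_dep predT) //= [leqLHS]big_mkcond /=.
apply: leq_sum => f _; case: ifP => //; rewrite inE => /andP[fI Af].
have fI' := injectiveP _ fI.
pose J := [set e in edges H | f @: (e : {set T}) \in A].
have fJ : [set f @: (e : {set T}) | e in J] = A.
  apply/setP => a; apply/imsetP/idP => [[e]|aA].
    by rewrite inE => /andP[_ ea] ->.
  have /imsetP[e eH ae] := subsetP Af a aA.
  by exists e => //; rewrite inE eH -ae.
rewrite (bigD1 J) //=; apply/andP; split; last by rewrite inE fI fJ eqxx.
rewrite -fJ card_imset ?eqxx ?andbT; last exact: imset_inj.
by apply/subsetP => e; rewrite inE => /andP[].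
Qed.

(** [J] together with its union as vertex set is one of the subgraphs over which
    m(H) is the maximum. *)
Lemma cover_density (J : {set {set T}}) : J \subset edges H -> (1 < #|J|)%N ->
  (l < #|cover J|)%N /\
  #|J|%:R - 1 <= mdensity R H * (#|cover J|%:R - l%:R).
Proof.
move=> JH J1.
have lJ : (l < #|cover J|)%N.
  have [e1 [e2 [e1J e2J e12]]] : exists e1 e2, [/\ e1 \in J, e2 \in J & e1 != e2].
    by have /card_gt1P[e1 [e2 []]] := J1; exists e1, e2.
  rewrite ltnNge; apply: contraNN e12 => cl.
  have full e : e \in J -> e = cover J.
    move=> eJ; have [_ el] := edges_lgraph (subsetP JH _ eJ).
    by apply/eqP; rewrite eqEcard (bigcup_sup e) //= el.
  by rewrite (full _ e1J) -(full _ e2J).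
split => //.
have Jl : is_lgraph l (cover J, J).
  apply/forallP => e; apply/implyP => /= eJ.
  have [_ ->] := edges_lgraph (subsetP JH _ eJ).
  by rewrite (bigcup_sup e) //= eqxx.
rewrite -ler_pdivrMr; last by rewrite subr_gt0 ltr_nat.
apply: (@le_bigmax_cond _ _ _ _ (LGraph Jl) _
   (fun H' : lgraph l T => ((nedges H')%:R - 1) / ((nverts H')%:R - l%:R))).
rewrite /subgraph JH J1 !andbT /=; apply/bigcupsP => e eJ.
by have [] := edges_lgraph (subsetP JH _ eJ).
Qed.

Hypothesis H_edges : (2 <= nedges H)%N.

(** Two edges span at most 2l vertices. *)
Lemma mdensity_ge_inv : 1 <= mdensity R H * l%:R.
Proof.
have /card_gt1P[e1 [e2 [e1H e2H e12]]] := H_edges.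
have JH : [set e1; e2] \subset edges H by rewrite subUset !sub1set e1H.
have c2 : #|[set e1; e2]| = 2%N by rewrite cards2 e12.
have [||lc md] := @cover_density [set e1; e2]; rewrite ?c2 //.
have [_ l1] := edges_lgraph e1H; have [_ l2] := edges_lgraph e2H.
have c2l : (#|cover [set e1; e2]| <= l + l)%N.
  by rewrite /cover bigcup_setU !big_set1 -{1}l1 -l2 cardsU leq_subr.
move: md; rewrite c2 => md.
have m0 : 0 <= mdensity R H by apply: bigmax_ge_id.
apply: (@le_trans _ _ (mdensity R H * (#|cover [set e1; e2]|%:R - l%:R))); first by lra.
by apply: ler_wpM2l => //; rewrite lerBlDr -natrD ler_nat.
Qed.

Lemma mdensity_gt0 : 0 < mdensity R H.
Proof.
have := mdensity_ge_inv; have [//|m0] := ltP 0 (mdensity R H).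
have : mdensity R H * l%:R <= 0 by rewrite mulr_le0_ge0.
by lra.
Qed.

(** With j = |J| and v the number of vertices of [J], this says
    N^(l-v) <= q^(j-1).  For j = 1 both sides are 1; for j > 1 it follows from
    q >= N^(-1/m(H)) and (j-1)/m(H) <= v - l. *)
Lemma expn_cover_le (N : nat) (q : R) (J : {set {set T}}) : (0 < N)%N ->
  N%:R `^ (- (1 / mdensity R H)) <= q -> J \subset edges H -> (0 < #|J|)%N ->
  N%:R ^+ l <= N%:R ^+ #|cover J| * q ^+ #|J|.-1 :> R.
Proof.
move=> N0 qN JH J0; have m0 := mdensity_gt0.
have [J1|J1] := leqP #|J| 1.
  have /eqP/cards1P[e Je] : #|J| = 1%N by apply/eqP; rewrite eqn_leq J1.
  have eH : e \in edges H by rewrite -sub1set -Je.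
  by rewrite Je cards1 /= expr0 mulr1 /cover big_set1; have [_ ->] := edges_lgraph eH.
have [lc md] := cover_density JH J1.
have N1 : 1 <= N%:R :> R by rewrite ler1n.
have NR0 : 0 < N%:R :> R by rewrite ltr0n.
apply: (@le_trans _ _ (N%:R ^+ #|cover J| * (N%:R `^ (- (1 / mdensity R H))) ^+ #|J|.-1)); last first.
  rewrite ler_pM2l ?exprn_gt0 //; apply: lerXn2r => //; rewrite ?nnegrE ?powR_ge0 //.
  exact: le_trans (powR_ge0 _ _) qN.
rewrite -!powR_mulrn ?powR_ge0 ?ler0n // -powRrM -powRD; last first.
  by apply/implyP => _; rewrite gt_eqF.
apply: ler_powR => //.
have -> : #|J|.-1%:R = #|J|%:R - 1 :> R by rewrite -subn1 natrB // ltnW.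
have : (#|J|%:R - 1) / mdensity R H <= #|cover J|%:R - l%:R.
  by rewrite ler_pdivrMr // mulrC.
have -> : - (1 / mdensity R H) * (#|J|%:R - 1) = - ((#|J|%:R - 1) / mdensity R H).
  by field; rewrite gt_eqF.
by lra.
Qed.

Lemma bin_le_expn (N : nat) : ('C(N, l) <= N ^ l)%N.
Proof.
apply: (@leq_trans (N ^_ l)); first by rewrite -bin_ffact leq_pmulr // fact_gt0.
rewrite ffact_prod -[l in (N ^ l)%N]card_ord -prod_nat_const.
by apply: leq_prod => i _; apply: leq_subr.
Qed.

Definition spread_constant : R := (2 ^ nedges H * #|T| ^ #|T|)%:R.

Lemma spread_constant_gt0 : (0 < spread_constant).
Proof.
rewrite ltr0n muln_gt0 expn_gt0 /=.
have [->//|T0] := posnP #|T|; by rewrite expn_gt0 T0.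
Qed.

Lemma copy_weight_spread (N : nat) (q : R) : (l <= N)%N -> (0 < N)%N -> (#|T| <= N)%N ->
  N%:R `^ (- (1 / mdensity R H)) <= q ->
  spread spread_constant (N%:R ^+ #|T| / 'C(N, l)%:R) q (@copy_weight N).
Proof.
move=> lN N0 TN qN A A0.
have NR0 : 0 < N%:R :> R by rewrite ltr0n.
have q0 : 0 < q by apply: lt_le_trans qN; apply: powR_gt0.
have C0 : 0 < 'C(N, l)%:R :> R by rewrite ltr0n bin_gt0.
pose B : R := N%:R ^+ #|T| / 'C(N, l)%:R * q ^+ #|A|.
have B0 : 0 <= B by rewrite mulr_ge0 ?divr_ge0 ?exprn_ge0 // ltW.
apply: (@le_trans _ _ (\sum_(J : {set {set T}} | (J \subset edges H) && (#|J| == #|A|))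
     (#|T| ^ #|T|)%:R * B)).
  apply: le_trans (ler_wpM2l (ltW q0) (codegree_bound A)) _.
  rewrite mulr_sumr; apply: ler_sum => J /andP[JH /eqP JA].
  rewrite natrM mulrCA ler_wpM2l //.
  have J0 : (0 < #|J|)%N by rewrite JA card_gt0.
  rewrite /B -JA -[#|J| in leRHS]prednK // exprS mulrCA ler_pM2l //.
  rewrite mulrAC ler_pdivlMr // natrX.
  have := expn_cover_le N0 qN JH J0 => h.
  have cT : (#|cover J| <= #|T|)%N by apply: max_card.
  apply: (@le_trans _ _ (N%:R ^+ (#|T| - #|cover J|) * N%:R ^+ l)).
    by rewrite ler_pM2l ?exprn_gt0 // -natrX ler_nat bin_le_expn.
  rewrite -[in leRHS](subnK cT) exprD -mulrA ler_pM2l ?exprn_gt0 //.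
rewrite sumr_const -[_ *+ _]mulr_natl /spread_constant natrM !mulrA.
rewrite -!mulrA ler_wpM2r ?mulr_ge0 ?exprn_ge0 ?invr_ge0 ?(ltW q0) //.
rewrite ler_nat -card_powerset; apply: subset_leq_card.
by apply/subsetP => J; rewrite !inE => /andP[].
Qed.

End CopyHypergraph.

(** * The union bound over fingerprints *)

Section Probability.
Variables (R : realType) (l N : nat).
Local Notation L := (lsets l N).

Lemma prod_lsets (F G : {set 'I_N} -> R) :
  \prod_(e in L) (F e + G e) =
  \sum_(X : {set {set 'I_N}} | X \subset L) \prod_(e in L) (if e \in X then F e else G e).
Proof.
have -> : \prod_(e in L) (F e + G e) =
    \prod_e ((if e \in L then F e else 0) + (if e \in L then G e else 1)).
  by rewrite big_mkcond; apply: eq_bigr => e _; case: ifP; rewrite ?add0r.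
rewrite bigA_distr [RHS]big_mkcond; apply: eq_bigr => X _.
case: ifPn => [XL|/subsetPn[e eX eL]].
  rewrite [RHS]big_mkcond; apply: eq_bigr => e _.
  case: (boolP (e \in L)) => eL //; case: ifP => // eX.
  by rewrite (subsetP XL _ eX) in eL.
by rewrite (bigD1 e) //= eX (negbTE eL) mul0r.
Qed.

Definition outcome_weight (p : R) (X : {set {set 'I_N}}) : R :=
  \prod_(e in L) (if e \in X then p else 1 - p).

Lemma outcome_weight_ge0 p X : 0 <= p -> p <= 1 -> 0 <= outcome_weight p X.
Proof. by move=> p0 p1; apply: prodr_ge0 => e _; case: ifP; rewrite ?subr_ge0. Qed.

Lemma Pr_random_lgraphE (p : R) (A : pred (lgraph l 'I_N)) :
  Pr_random_lgraph p A =
  \sum_(X : {set {set 'I_N}} | (X \subset L) && A (spanning l X)) outcome_weight p X.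
Proof.
rewrite /Pr_random_lgraph (reindex_onto (@spanning l N) (fun G => edges G)) /=.
  have EX (X : {set {set 'I_N}}) : (edges (spanning l X) == X) = (X \subset L).
    by rewrite /edges /=; apply/eqP/setIidPl.
  apply: eq_big => [X|X /andP[_]].
    by rewrite EX /verts /= eqxx andbC.
  rewrite EX => XL; have -> : edges (spanning l X) = X by apply/eqP; rewrite EX.
  by apply: eq_bigl => e; rewrite inE.
move=> G /andP[/eqP VG _]; apply/val_inj => /=.
rewrite (setIidPl _); last by apply/subsetP => e /edges_lgraph[_ el]; rewrite inE el.
by rewrite -VG /verts /edges; case: (lgraph_val G).
Qed.

Lemma Pr_random_lgraphC (p : R) (A : pred (lgraph l 'I_N)) :
  Pr_random_lgraph p A = 1 -
  \sum_(X : {set {set 'I_N}} | (X \subset L) && ~~ A (spanning l X)) outcome_weight p X.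
Proof.
apply/eqP; rewrite eq_sym subr_eq; apply/eqP.
have := prod_lsets (fun=> p) (fun=> 1 - p).
rewrite big1 => [->|e _]; last by rewrite addrC subrK.
by rewrite Pr_random_lgraphE (bigID (fun X => A (spanning l X))).
Qed.

(** For fixed S, exponential moments bound the probability that X contains S and
    has at least a elements in C(S) by
    exp(- lam a) (p e^lam)^|S| exp(p (e^lam - 1) m).  The sum over the sets S of
    size at most s is treated in the same way: inserting the factor
    exp(y (s - |S|)) >= 1 allows S to range over all subsets, and the binomial
    formula gives exp(y s) (1 + p e^(lam - y))^n. *)
Lemma fingerprint_union_bound (p lam y a m s : R)
    (C : {set {set 'I_N}} -> {set {set 'I_N}}) (bad : pred {set {set 'I_N}}) :
  0 <= p -> p <= 1 -> 0 <= lam -> 0 <= y ->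
  (forall X : {set {set 'I_N}}, X \subset L -> bad X -> exists S : {set {set 'I_N}},
     [/\ S \subset X, #|S|%:R <= s, #|C S|%:R <= m & a <= #|X :&: C S|%:R]) ->
  \sum_(X : {set {set 'I_N}} | (X \subset L) && bad X) outcome_weight p X <=
  expR (- lam * a + p * (expR lam - 1) * m + y * s + p * expR (lam - y) * #|L|%:R).
Proof.
move=> p0 p1 lam0 y0 badP.
pose good (S : {set {set 'I_N}}) := [&& S \subset L, #|S|%:R <= s & #|C S|%:R <= m].
(* The product vanishes unless S is contained in X, and then equals the weight of
   X times exp(lam |X meet C(S)|). *)
pose term (S X : {set {set 'I_N}}) : R := expR (- lam * a) *
  \prod_(e in L) (if e \in X then p * (if e \in C S then expR lam else 1)
                  else (1 - p) * (e \notin S)%:R).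
have e1 : 1 <= expR lam by rewrite -[leLHS]expR0 ler_expR.
have term0 S X : 0 <= term S X.
  rewrite mulr_ge0 ?expR_ge0 //; apply: prodr_ge0 => e _.
  by case: ifP => _; rewrite mulr_ge0 ?subr_ge0 //; case: ifP => _; rewrite ?expR_ge0.
apply: (@le_trans _ _ (\sum_(X : {set {set 'I_N}} | X \subset L) \sum_(S | good S) term S X)).
  rewrite big_mkcondr /=; apply: ler_sum => X XL; case: ifP => [bX|_]; last exact: sumr_ge0.
  have [S [SX Ss Cm aX]] := badP X XL bX.
  rewrite (bigD1 S) /=; last by rewrite /good Ss Cm (subset_trans SX XL).
  apply: (@le_trans _ _ (term S X)); last by rewrite lerDl sumr_ge0.
  have -> : term S X = expR (lam * (#|X :&: C S|%:R - a)) * outcome_weight p X.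
    rewrite mulrBr expRD expRM_natr -mulNr /term mulrAC mulrC; congr (_ * _).
    rewrite -prodr_const /outcome_weight [\prod_(i in _ :&: _) _]big_mkcond /=.
    have -> : \prod_i (if i \in X :&: C S then expR lam else 1) =
        \prod_(e in L) (if e \in X :&: C S then expR lam else 1).
      rewrite [RHS]big_mkcond; apply: eq_bigr => e _.
      case: (boolP (e \in L)) => // eL; rewrite inE.
      by case: (boolP (e \in X)) => // /(subsetP XL); rewrite (negbTE eL).
    rewrite -big_split /=; apply: eq_bigr => e eL; rewrite inE.
    case: ifP => eX /=; first by rewrite mulrC.
    by rewrite mul1r; case: (boolP (e \in S)) => [/(subsetP SX)|_]; rewrite ?eX ?mulr1.
  have ge1 : 1 <= expR (lam * (#|X :&: C S|%:R - a)).
    by rewrite -[leLHS]expR0 ler_expR mulr_ge0 // subr_ge0.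
  by rewrite ler_peMl // outcome_weight_ge0.
rewrite exchange_big /=.
pose z := p * expR lam.
have z0 : 0 <= z by rewrite mulr_ge0 ?expR_ge0.
pose K := expR (- lam * a) * expR (p * (expR lam - 1) * m).
have K0 : 0 <= K by rewrite mulr_ge0 ?expR_ge0.
apply: (@le_trans _ _ (\sum_(S | good S) K * z ^+ #|S|)).
  apply: ler_sum => S /and3P[SL Ss Cm].
  rewrite /term -mulr_sumr -prod_lsets /K -mulrA ler_pM2l ?expR_gt0 //.
  apply: (@le_trans _ _ (\prod_(e in L) ((if e \in C S then expR (p * (expR lam - 1)) else 1)
     * (if e \in S then z else 1)))).
    apply: ler_prod => e _; apply/andP; split.
      rewrite addr_ge0 // mulr_ge0 ?subr_ge0 //; by case: ifP => _; rewrite ?expR_ge0.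
    have q1 : 1 <= expR (p * (expR lam - 1)).
      by rewrite -[leLHS]expR0 ler_expR mulr_ge0 // subr_ge0.
    have q2 := expR_ge1Dx (p * (expR lam - 1)).
    case: (boolP (e \in S)) => eS; case: (boolP (e \in C S)) => eC; rewrite /= ?mulr0 ?mulr1 ?addr0 ?mul1r.
    - by rewrite ler_peMl.
    - by rewrite ler_peMr.
    - by apply: le_trans q2; rewrite le_eqVlt; apply/orP; left; apply/eqP; ring.
    - by rewrite addrC subrK.
  rewrite big_split /= ler_pM //.
  - by apply: prodr_ge0 => e _; case: ifP; rewrite ?expR_ge0.
  - by apply: prodr_ge0 => e _; case: ifP.
  - rewrite -big_mkcondr /= prodr_const -expRM_natr ler_expR ler_wpM2l //.
      by rewrite mulr_ge0 // subr_ge0.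
    apply: le_trans Cm; rewrite ler_nat; apply/subset_leq_card/subsetP => e.
    by rewrite unfold_in => /andP[].
  - rewrite -big_mkcondr /= prodr_const.
    rewrite (_ : #|_| = #|S|) //; apply: eq_card => e; rewrite unfold_in /=.
    by case: (boolP (e \in S)) => [/(subsetP SL)->|]; rewrite ?andbF.
have -> : expR (- lam * a + p * (expR lam - 1) * m + y * s + p * expR (lam - y) * #|L|%:R) =
    K * (expR (y * s) * expR (p * expR (lam - y) * #|L|%:R)).
  by rewrite /K -!expRD !addrA.
rewrite -mulr_sumr ler_wpM2l //.
pose x := z * expR (- y).
have x0 : 0 <= x by rewrite mulr_ge0 ?expR_ge0.
apply: (@le_trans _ _ (\sum_(S : {set {set 'I_N}} | S \subset L) expR (y * s) * x ^+ #|S|)).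
  rewrite [leLHS]big_mkcond [leRHS]big_mkcond /=; apply: ler_sum => S _.
  rewrite /good; case: (S \subset L) => //=; case: ifP => [/andP[Ss _]|_]; last first.
    by rewrite mulr_ge0 ?expR_ge0 ?exprn_ge0.
  have -> : x ^+ #|S| = z ^+ #|S| * expR (- y * #|S|%:R) by rewrite expRM_natr -exprMn.
  rewrite mulrCA -expRD ler_peMr ?exprn_ge0 //.
  by rewrite -[leLHS]expR0 ler_expR mulNr -mulrBr mulr_ge0 // subr_ge0.
rewrite -mulr_sumr ler_pM2l ?expR_gt0 //.
have := prod_lsets (fun=> x) (fun=> 1).
rewrite prodr_const => eq1.
rewrite (eq_bigr (fun S : {set {set 'I_N}} => \prod_(e in L) (if e \in S then x else 1)))
  => [|S SL]; last first.
  rewrite -big_mkcondr /= prodr_const; congr (_ ^+ _); apply: eq_card => e; rewrite [RHS]unfold_in /=.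
  by case: (boolP (e \in S)) => [/(subsetP SL)->|]; rewrite ?andbF.
rewrite -eq1 expRM_natr lerXn2r ?nnegrE ?addr_ge0 ?expR_ge0 //.
have -> : p * expR (lam - y) = x by rewrite expRD mulrA.
by rewrite addrC expR_ge1Dx.
Qed.

End Probability.

(** * Sparse Turán theorem *)

Section SparseTuran.

Lemma expR_le_quadratic (R : realType) (x : R) : 0 <= x -> x <= 2^-1 ->
  expR x <= 1 + x + 2 * x ^+ 2.
Proof.
move=> x0 x2; have := expR_ge1Dx (- x); rewrite expRN => h.
have x1 : 0 < 1 - x by lra.
have : expR x * (1 - x) <= 1.
  by rewrite mulrC -ler_pdivlMr ?expR_gt0 // mul1r.
rewrite -ler_pdivlMr // => h2; apply: le_trans h2 _.
rewrite ler_pdivrMr //; nra.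
Qed.

Variables (R : realType) (l : nat) (T : finType) (H : lgraph l T).
Hypothesis H_edges : (2 <= nedges H)%N.

(** The reference average degree is N^|T| / C(N,l), so that fewer than
    alpha D n copies means fewer than alpha N^|T|. *)
Lemma turan_containers (eps : R) : 0 < eps ->
  exists2 b : R, 0 < b &
  exists N0 : nat, forall N : nat, (N0 <= N)%N -> forall q : R,
  N%:R `^ (- (1 / mdensity R H)) <= q -> q <= 1 ->
  exists S C : {set {set 'I_N}} -> {set {set 'I_N}},
  forall I : {set {set 'I_N}}, I \subset lsets l N -> copies H I = set0 ->
    [/\ contains_with (lsets l N) (b * q * 'C(N, l)%:R) S C I
      & #|C I|%:R <= (turan_density R H + eps) * 'C(N, l)%:R].
Proof.
move=> e0; have [a a0 [N1 sup]] := supersaturation H e0.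
have [b b0 cont] := containers (nedges H) (spread_constant_gt0 R H) a0.
exists b => //; exists (maxn N1 (maxn #|T| l).+1) => N; rewrite geq_max => /andP[N1N TlN] q qN q1.
have [TN lN] : (#|T| <= N /\ l <= N)%N.
  by split; apply: leq_trans (ltnW TlN); rewrite ?leq_maxl ?leq_maxr.
have N0 : (0 < N)%N by apply: leq_trans TlN.
have NR0 : 0 < N%:R :> R by rewrite ltr0n.
have C0 : 0 < 'C(N, l)%:R :> R by rewrite ltr0n bin_gt0.
have q0 : 0 < q by apply: lt_le_trans qN; apply: powR_gt0.
have D0 : 0 < N%:R ^+ #|T| / 'C(N, l)%:R :> R by rewrite divr_gt0 ?exprn_gt0.
have Un : #|lsets l N|%:R <= 'C(N, l)%:R :> R by rewrite card_lsets.
have [S [C SC]] := cont _ _ _ _ _ _ C0 D0 q0 q1 Un (fun E => ler0n R _)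
  (@copy_weight_uniform R l T H N) (copy_weight_spread H_edges lN N0 TN qN).
exists S, C => I IL I0.
have [cw sm] := SC I IL (copy_weight_independent R I0); split => //.
have [_ _ _ CL _] := cw.
rewrite leNgt; apply/negP => big; have := sup N N1N (C I) CL (ltW big).
rewrite leNgt => /negP; apply; move: sm; rewrite mass_restrict_copy_weight.
by rewrite mulrA divfK ?gt_eqF.
Qed.

Lemma expn_le_bin (N : nat) : (2 * l <= N)%N -> (N ^ l <= 2 ^ l * l`! * 'C(N, l))%N.
Proof.
move=> lN; rewrite -mulnA [(l`! * _)%N]mulnC bin_ffact; exact: expn_leq_ffact.
Qed.

(** Up to a constant C(N,l) is N^l, and l >= 1/m(H); hence p C(N,l) is at least a
    constant times c. *)
Lemma powR_bin_ge (N : nat) : (0 < N)%N -> (2 * l <= N)%N ->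
  1 <= (2 ^ l * l`!)%:R * (N%:R `^ (- (1 / mdensity R H)) * 'C(N, l)%:R).
Proof.
move=> N0 lN; have NR0 : 0 < N%:R :> R by rewrite ltr0n.
have m0 := mdensity_gt0 R H_edges.
rewrite mulrCA -natrM; apply: (@le_trans _ _ (N%:R `^ (- (1 / mdensity R H)) * N%:R ^+ l)).
  rewrite -powR_mulrn ?ler0n // -powRD; last by apply/implyP => _; rewrite gt_eqF.
  rewrite -[leLHS](powRr0 N%:R); apply: ler_powR; first by rewrite ler1n.
  rewrite addrC subr_ge0 ler_pdivrMr // mulrC; exact: mdensity_ge_inv.
by rewrite ler_pM2l ?powR_gt0 // -natrX ler_nat expn_le_bin.
Qed.

Lemma card_edges_small (N : nat) (F : lgraph l 'I_N) :
  (#|verts F| <= #|T|)%N -> (nedges F <= 2 ^ #|T|)%N.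
Proof.
move=> FT; apply: (@leq_trans (2 ^ #|verts F|)); last by rewrite leq_pexp2l.
rewrite -card_powerset; apply/subset_leq_card/subsetP => e /edges_lgraph[eF _].
by rewrite inE.
Qed.

End SparseTuran.

Theorem theorem2p12 (R : realType) (l : nat) (T : finType) (H : lgraph l T)
    (H_edges : (2 <= nedges H)%N) (gamma : R)
    (gamma_gt0 : 0 < gamma) (gamma_lt1 : gamma < 1) :
  exists2 c : R, 0 < c &
  exists N0 : nat, forall N : nat, (N0 <= N)%N ->
  forall p : R, c * N%:R `^ (- (1 / mdensity R H)) <= p -> p <= 1 ->
  1 - expR (- (gamma ^+ 3 * p * 'C(N, l)%:R / 512%:R)) <
  Pr_random_lgraph p (fun G : lgraph l 'I_N =>
    [forall F : lgraph l 'I_N, (subgraph F G && is_free H F) ==>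
      ((nedges F)%:R <= (turan_density R H + gamma) * p * 'C(N, l)%:R)]).
Proof.
have e0 : 0 < gamma / 4 by rewrite divr_gt0.
have [b b0 [N1 cont]] := turan_containers H_edges e0.
set pi := turan_density R H in cont *.
have pi0 : 0 <= pi := turan_density_ge0 R H.
(* The exponent of the union bound, divided by p C(N,l), has three parts.  The
   Chernoff part is at most -3/4 gamma lam + 2 lam^2 = -gamma^2/16; y and tau are
   chosen so that each of the other two is at most gamma^2/64. *)
pose lam := gamma / 4.
have g2 : 0 < gamma ^+ 2 by rewrite exprn_gt0.
have g21 : gamma ^+ 2 < 1 by rewrite exprn_ilt1 // ltW.
pose y := ln (128 / gamma ^+ 2).
have Ey : expR (- y) = gamma ^+ 2 / 128.
  by rewrite expRN /y lnK ?posrE ?divr_gt0 // invf_div.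
have y0 : 0 < y by rewrite ln_gt0 // ltr_pdivlMr //; lra.
pose tau := Num.min 1 (gamma ^+ 2 / (64 * b * y)).
have by0 : 0 < 64 * b * y by rewrite !mulr_gt0.
have tau0 : 0 < tau by rewrite lt_min ltr01 divr_gt0.
have tau1 : tau <= 1 by rewrite ge_min lexx.
have tau2 : y * (b * tau) <= gamma ^+ 2 / 64.
  have : tau <= gamma ^+ 2 / (64 * b * y) by rewrite ge_min lexx orbT.
  rewrite ler_pdivlMr // ler_pdivlMr // => h; apply: le_trans h.
  by rewrite le_eqVlt; apply/orP; left; apply/eqP; ring.
(* Q makes the 2^|T| edges of an F with few vertices at most gamma p C(N,l). *)
pose Q : R := (2 ^ #|T|)%:R * (2 ^ l * l`!)%:R / gamma.
have Q0 : 0 < Q.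
  by rewrite divr_gt0 // mulr_gt0 // ltr0n ?muln_gt0 ?expn_gt0 ?fact_gt0.
exists (tau^-1 + Q); first by rewrite addr_gt0 ?invr_gt0.
exists (maxn N1 (2 * l).+1) => N; rewrite geq_max => /andP[N1N lN] p pN p1.
have N0 : (0 < N)%N by apply: leq_trans lN.
have NR0 : 0 < N%:R :> R by rewrite ltr0n.
have C0 : 0 < 'C(N, l)%:R :> R by rewrite ltr0n bin_gt0 (leq_trans _ (ltnW lN)) ?leq_pmull.
set n : R := 'C(N, l)%:R in C0 *.
set r := N%:R `^ _ in pN.
have r0 : 0 < r by apply: powR_gt0.
have p0 : 0 < p by apply: lt_le_trans pN; rewrite mulr_gt0 // addr_gt0 ?invr_gt0.
have pn0 : 0 < p * n by rewrite mulr_gt0.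
have pr : r <= tau * p.
  rewrite mulrC -ler_pdivrMr // mulrC; apply: le_trans pN.
  by rewrite ler_pM2r // lerDl ltW.
have pQ : (2 ^ #|T|)%:R <= gamma * (p * n).
  have : Q * r <= p by apply: le_trans pN; rewrite ler_pM2r // lerDr invr_ge0 ltW.
  rewrite -(ler_pM2r C0) -(ler_pM2l gamma_gt0) => h; apply: le_trans h.
  have -> : gamma * (Q * r * n) = (2 ^ #|T|)%:R * ((2 ^ l * l`!)%:R * (r * n)).
    by rewrite /Q; field; rewrite gt_eqF.
  by rewrite ler_peMr // /r /n powR_bin_ge // ltnW.
have tp1 : tau * p <= 1 by rewrite -[leRHS]mulr1 ler_pM // ltW.
have [S [C SC]] := cont N N1N (tau * p) pr tp1.
set A := (X in Pr_random_lgraph _ X).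
rewrite Pr_random_lgraphC ltrD2l ltrN2.
(* The cap C(N,l) on the container keeps the quadratic term of e^lam - 1 below
   2 lam^2 p C(N,l). *)
apply: (@le_lt_trans _ _ (expR (- lam * ((pi + gamma) * p * n)
   + p * (expR lam - 1) * (Num.min 1 (pi + gamma / 4) * n)
   + y * (b * (tau * p) * n) + p * expR (lam - y) * #|lsets l N|%:R))).
  apply: (@fingerprint_union_bound R l N p lam y _ _ _ (fun I => C I :&: lsets l N)
    (fun X => ~~ A (spanning l X))); rewrite ?(ltW p0) ?(ltW y0) ?(ltW e0) //.
  move=> X XL; rewrite /A negb_forall => /existsP[F]; rewrite negb_imply -ltNge.
  move=> /andP[/andP[/andP[_ FX] frF] bigF].
  rewrite /edges /= -/(edges F) in FX; have {}FX := subset_trans FX (subsetIl _ _).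
  have FL : edges F \subset lsets l N by apply: subset_trans FX XL.
  have TF : (#|T| <= #|verts F|)%N.
    rewrite leqNgt; apply/negP => /ltnW/card_edges_small; rewrite -(ler_nat R) => small.
    have := le_trans small pQ; rewrite leNgt => /negP; apply; apply: le_lt_trans bigF.
    by rewrite -mulrA ler_wpM2r ?(ltW pn0) // lerDr.
  have F0 : copies H (edges F) = set0 by apply/eqP; rewrite -free_copies.
  have [[SF cS FC CL rec] cC] := SC _ FL F0.
  have [_ eC] := rec _ (subxx _) SF.
  exists (S (edges F)); split => //.
  - exact: subset_trans SF FX.
  - rewrite eC (setIidPl CL) minr_pMl ?(ltW C0) // le_min mul1r cC andbT.
    by rewrite /n -card_lsets ler_nat subset_leq_card.
  - apply: le_trans (ltW bigF) _; rewrite ler_nat; apply: subset_leq_card.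
    by rewrite eC (setIidPl CL) subsetI FX FC.
rewrite ltr_expR card_lsets -/n.
have lam0 : 0 <= lam by apply: ltW.
have lam2 : lam <= 2^-1 by rewrite /lam; lra.
have q := expR_le_quadratic lam0 lam2.
have l2 : 2 * lam ^+ 2 = gamma ^+ 2 / 8 by rewrite /lam; field.
set M := Num.min 1 (pi + gamma / 4).
have M1 : M <= 1 by rewrite ge_min lexx.
have M2 : M <= pi + gamma / 4 by rewrite ge_min lexx orbT.
have M0 : 0 <= M by rewrite le_min ler01 addr_ge0 // ltW.
have s1 : (expR lam - 1) * M <= lam * (pi + gamma / 4) + 2 * lam ^+ 2.
  apply: (@le_trans _ _ ((lam + 2 * lam ^+ 2) * M)).
    by rewrite ler_wpM2r //; lra.
  rewrite mulrDl lerD //; first by rewrite ler_wpM2l.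
  by rewrite ler_piMr // mulr_ge0 // exprn_ge0.
have s2 : expR (lam - y) <= gamma ^+ 2 / 64.
  rewrite expRD Ey; apply: (@le_trans _ _ (2 * (gamma ^+ 2 / 128))); last by lra.
  by rewrite ler_pM2r ?divr_gt0 //; apply: le_trans q _; rewrite l2 /lam; lra.
have -> : - lam * ((pi + gamma) * p * n) + p * (expR lam - 1) * (M * n) +
   y * (b * (tau * p) * n) + p * expR (lam - y) * n =
   (p * n) * (- lam * (pi + gamma) + (expR lam - 1) * M + y * (b * tau) + expR (lam - y)).
  by ring.
have -> : - (gamma ^+ 3 * p * n / 512) = (p * n) * (- (gamma ^+ 3 / 512)) by ring.
rewrite ltr_pM2l //.
have g3 : gamma ^+ 3 <= gamma ^+ 2.
  by rewrite exprS ler_piMl ?exprn_ge0 // ltW.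
have ll : lam * (pi + gamma) = lam * (pi + gamma / 4) + 3 / 16 * gamma ^+ 2.
  by rewrite /lam; field.
by lra.
Qed.
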